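(* Let $(X,Y)\in[0,2\pi]\times\mathbb{R}$ be random variables with $\mathbb{E}[Y^2]<\infty$, $X$ uniformly distributed on $[0,2\pi]$, and let $s_*(X)=\mathbb{E}[Y\mid X]$. Fix $\nu>1/2$, $L_1,L_2>0$ and assume $s_*\in\Lambda_\nu(L_1,L_2)$. Let $m=\mathrm{Span}\{\varphi_1,\dots,\varphi_D\}$ (the first $D$ Fourier functions), let $s_m$ be the orthogonal projection of $s_*$ onto $m$ in $L_2(P^X)$, set $\zeta=Y-s_m(X)$, and assume $\zeta$ is independent of $X$ and $\mathbb{E}\zeta^2\leq\sigma^2$ for some $\sigma>0$. Given an i.i.d. sample $(X_i,Y_i)_{i=1}^n$ distributed as $(X,Y)$, let $\hat s_m\in\arg\min_{s\in m}\frac1n\sum_{i=1}^n(Y_i-s(X_i))^2$. Then there exist constants $L_\nu$ (depending only on $\nu$), $L_{L_1,L_2,\sigma,\nu}$ (depending only on $L_1,L_2,\sigma,\nu$), $C_{\nu,L_1,L_2}>0$ and $\beta_0>0$ (depending only on $\nu,L_1,L_2$), and an integer $n_0(\nu,L_1,L_2)$ such that, if \[ 0<\big(2\sqrt2L_1L_2^{-1}\big)^{1/\nu}\leq D\leq L_\nu\Big(\frac{n}{\ln n}\Big)^{\frac1{2(\nu+1)}} \] and $x\in\big(0,\,L_{L_1,L_2,\sigma,\nu}\,n/D^{2(\nu+1)}\big)$, then for every $n\geq n_0(\nu,L_1,L_2)$, on an event of probability at least $1-\exp(-\beta_0^2n/4)-n^{-2}-2/x$, \[ \|\hat s_m-s_m\|_2^2\leq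 C_{\nu,L_1,L_2}\frac{\sigma^2Dx}{n}. \]
   Context: Fourier functions: $\varphi_1\equiv1$, $\varphi_{2k}(x)=\sqrt2\cos(kx)$, $\varphi_{2k+1}(x)=\sqrt2\sin(kx)$ for $k\geq1$; $\langle f,g\rangle=\int fg\,dP^X$ with $P^X$ uniform on $[0,2\pi]$, $\|\cdot\|_2$ the associated norm, $\beta_k(f)=\langle f,\varphi_k\rangle$ for $2\pi$-periodic $f$. For $\nu,L_1,L_2>0$, $\Lambda_\nu(L_1,L_2)=\{f\in L_\infty(\mathbb{T}):\sum_{k\geq1}k^\nu|\beta_k(f)|\leq L_1\text{ and }\|f\|_\infty\geq L_2\}$, where $L_\infty(\mathbb{T})$ denotes bounded $2\pi$-periodic functions. *)

(* Defs.v *)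
From HB Require Import structures.
From mathcomp Require Import all_boot all_order all_algebra.
From mathcomp Require Import all_classical all_reals all_analysis.
Set Implicit Arguments. Unset Strict Implicit. Unset Printing Implicit Defensive.
Import Order.TTheory GRing.Theory Num.Theory.
Import numFieldNormedType.Exports.
Local Open Scope classical_set_scope.
Local Open Scope ring_scope.

Section Defs.
Variable R : realType.

(* Fourier functions: phi 1 = 1, phi (2k) = sqrt2 cos(kx), phi (2k+1) = sqrt2 sin(kx);
   phi 0 is unused (set to 0). *)
Definition phi (k : nat) (x : R) : R :=
  match k with
  | 0 => 0
  | 1 => 1
  | _ => if odd k then Num.sqrt 2 * sin ((k./2)%:R * x)
         else Num.sqrt 2 * cos ((k./2)%:R * x)
  end.

(* <f, g> = int f g dP^X, P^X uniform on [0, 2 pi] *)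
Definition ipX (f g : R -> R) : R :=
  (2 * pi)^-1 * \int[@lebesgue_measure R]_(x in `[0, 2 * pi]) (f x * g x).

Definition norm2sq (f : R -> R) : R := ipX f f.

Definition beta (k : nat) (f : R -> R) : R := ipX f (phi k).

Definition Linf_T (f : R -> R) : Prop :=
  [/\ measurable_fun setT f,
      (forall x, f (x + 2 * pi) = f x)
    & exists M : R, forall x, `|f x| <= M].

Definition supnorm (f : R -> R) : R := sup (range (fun x => `|f x|)).

Definition Lambda (nu L1 L2 : R) (f : R -> R) : Prop :=
  [/\ Linf_T f,
      (\sum_(1 <= k <oo) (((k%:R) `^ nu * `|beta k f|)%:E) <= L1%:E)%E
    & L2 <= supnorm f].

Definition lincomb (D : nat) (c : nat -> R) (x : R) : R :=
  \sum_(1 <= k < D.+1) c k * phi k x.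

Definition projm (D : nat) (f : R -> R) : R -> R :=
  lincomb D (fun k => beta k f).

Definition emp_risk (n : nat) (xs ys : 'I_n -> R) (s : R -> R) : R :=
  n%:R^-1 * \sum_(i < n) (ys i - s (xs i)) ^+ 2.

Definition I02pi : set R := `[0, 2 * pi]%classic.

End Defs.

Section Proba.
Context {R : realType} {d : measure_display} {T : measurableType d}.
Variable P : probability T R.

Definition uniform_0_2pi (X : T -> R) : Prop :=
  forall A : set R, measurable A ->
    P (X @^-1` A) = (((2 * pi)^-1)%:E * @lebesgue_measure R (A `&` @I02pi R))%E.

Definition is_condexp_fun (Y X : T -> R) (s : R -> R) : Prop :=
  measurable_fun setT s /\
  forall A : set R, measurable A ->
    (\int[P]_(t in X @^-1` A) (Y t)%:E = \int[P]_(t in X @^-1` A) (s (X t))%:E)%E.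

Definition indep2 (X Z : T -> R) : Prop :=
  forall A B : set R, measurable A -> measurable B ->
    P (X @^-1` A `&` Z @^-1` B) = (P (X @^-1` A) * P (Z @^-1` B))%E.

(* (Xs i, Ys i)_{i<n} are mutually independent and each distributed as (X, Y)
   (laws on R x R compared on measurable rectangles, a generating pi-system) *)
Definition iid_sample (X Y : T -> R) (n : nat) (Xs Ys : 'I_n -> T -> R) : Prop :=
  [/\ forall i, measurable_fun setT (Xs i) /\ measurable_fun setT (Ys i),
      (forall i (A B : set R), measurable A -> measurable B ->
         P (Xs i @^-1` A `&` Ys i @^-1` B) = P (X @^-1` A `&` Y @^-1` B))
    & forall A B : 'I_n -> set R, (forall i, measurable (A i) /\ measurable (B i)) ->
         P (\bigcap_(i in [set: 'I_n]) (Xs i @^-1` A i `&` Ys i @^-1` B i)) =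
         (\big[*%E/1%E]_(i < n) P (Xs i @^-1` A i `&` Ys i @^-1` B i))%E].

End Proba.

(* Main.v *)
Require Import Defs.
From HB Require Import structures.
From mathcomp Require Import all_boot all_order all_algebra.
From mathcomp Require Import all_classical all_reals all_analysis.
From mathcomp Require Import measurable_realfun zify ring lra.
Set Implicit Arguments.
Unset Strict Implicit.
Unset Printing Implicit Defensive.
Import Order.TTheory GRing.Theory Num.Theory.
Import numFieldNormedType.Exports.
Local Open Scope classical_set_scope.
Local Open Scope ring_scope.

(** With w the difference between the estimator and s_m, minimality of the
    empirical risk at the estimator, compared with s_m, gives
    ||w||_n^2 <= 2 sum_k w_k nu_k, where w_k are the Fourier coefficients of w
    and nu_k is the empirical mean of zeta phi_k(X).
    If the empirical Gram matrix of the phi_k is within 1/(2D) of the identity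
    entrywise, then ||w||_n^2 >= ||w||_2^2 / 2, and completing squares yields
    ||w||_2^2 <= 16 sum_k nu_k^2.
    The Gram condition fails with probability at most n^-2 by exponential tail
    bounds for its D^2 entries, because D^2 ln n <= n / 3600.  Conditional
    expectation makes zeta phi_k(X) centred, so sum_k nu_k^2 has mean at most
    2 D sigma^2 / n and Markov's inequality accounts for the term 2 / x. *)

(** * Integrals of functions of a random element *)

(** The two sources of error call for different tools. Gram entries are averages of bounded
    variables, so exponential moments exist and a union bound over all entries is affordable. The
    noise is only known to have a second moment, so Markov's inequality is applied to it, and this
    is why the confidence decays like 1 / x. The obstacle is that independence and conditional
    expectation are given through events, while the argument needs expectations of products of
    functions. The bridge is [Rintegral_comp_eq0]: a variable that integrates to 0 over every event
    determined by [Z] is orthogonal to every function of [Z] for which the product is integrable. It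
    yields the product rule behind the exponential moments, the uncorrelatedness of the noise terms,
    and the use of the conditional expectation. Each time some quantity is first centred, so that
    its integrals over events vanish. *)

Section integral_composition.
Context {d d' : measure_display} {T : measurableType d} {U : measurableType d'}.
Context {R : realType} (mu : {measure set T -> \bar R}).
Variables (Z : T -> U).
Hypothesis mZ : measurable_fun setT Z.

Import HBNNSimple.

(** In this form [H] enters only through its integrals over preimages under [Z], the data that the
    hypothesis of [ge0_integral_comp_eq] compares. *)
Lemma ge0_integral_comp_sfun (H : T -> R) (h : {nnsfun U >-> R}) :
  measurable_fun setT H -> (forall t, 0 <= H t) ->
  (\int[mu]_t ((h (Z t))%:E * (H t)%:E) =
   \sum_(y \in range h)
     y%:E * \int[mu]_(t in Z @^-1` (h @^-1` [set y])) (H t)%:E)%E.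
Proof.
move=> mH H0.
have mEH : measurable_fun setT (EFin \o H) by exact/measurable_EFinP.
have mA y : measurable (Z @^-1` (h @^-1` [set y])).
  by rewrite -[X in measurable X]setTI; exact: mZ.
have mI y : measurable_fun setT
    (fun t => \1_(Z @^-1` (h @^-1` [set y])) t : R).
  exact: measurable_indic.
transitivity (\int[mu]_t (\sum_(y \in range h)
    ((y * \1_(Z @^-1` (h @^-1` [set y])) t)%:E * (H t)%:E)))%E.
  apply: eq_integral => t _.
  rewrite -ge0_mule_fsuml; last first.
    by move=> y; have := nnfun_muleindic_ge0 h y (Z t).
  by rewrite fsumEFin // [h (Z t)]fimfunE.
rewrite ge0_integral_fsum//; last 2 first.
- move=> y; apply: emeasurable_funM => //.
  by apply/measurable_EFinP; exact: measurable_funM.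
- move=> y t _; apply: mule_ge0; last by rewrite lee_fin.
  by have := nnfun_muleindic_ge0 h y (Z t).
apply: eq_fsbigr => y /[!inE] -[u _ <-].
under eq_integral do rewrite EFinM -muleA.
rewrite ge0_integralZl//; last 3 first.
- by apply: emeasurable_funM => //; apply/measurable_EFinP.
- by move=> t _; rewrite mule_ge0// lee_fin.
- by rewrite lee_fin.
congr (_ * _)%E; rewrite [RHS]integral_mkcond; apply: eq_integral => t _.
by rewrite epatch_indic muleC.
Qed.

(** For simple [f] both sides are the same finite sum; increasing simple approximations of [f] and
    monotone convergence give the rest, with infinite values allowed. *)
Lemma ge0_integral_comp_eq (H1 H2 : T -> R) (f : U -> R) :
  measurable_fun setT H1 -> (forall t, 0 <= H1 t) ->
  measurable_fun setT H2 -> (forall t, 0 <= H2 t) ->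
  (forall A, measurable A ->
    \int[mu]_(t in Z @^-1` A) (H1 t)%:E = \int[mu]_(t in Z @^-1` A) (H2 t)%:E)%E ->
  measurable_fun setT f -> (forall u, 0 <= f u) ->
  (\int[mu]_t ((f (Z t))%:E * (H1 t)%:E) =
   \int[mu]_t ((f (Z t))%:E * (H2 t)%:E))%E.
Proof.
move=> mH1 H10 mH2 H20 H12 mf f0.
have mEf : measurable_fun setT (EFin \o f) by exact/measurable_EFinP.
pose h := nnsfun_approx measurableT mEf.
have lim_int (H : T -> R) : measurable_fun setT H ->
    (forall t, 0 <= H t) ->
    (\int[mu]_t ((f (Z t))%:E * (H t)%:E) =
     limn (fun n => \int[mu]_t ((h n (Z t))%:E * (H t)%:E)))%E.
  move=> mH H0; rewrite -monotone_convergence//.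
  - apply: eq_integral => t _; apply/esym/cvg_lim => //.
    apply: cvgeZr => //.
    by apply: (cvg_nnsfun_approx _ mEf) => //= u _; rewrite lee_fin.
  - move=> n; apply: emeasurable_funM; last exact/measurable_EFinP.
    by apply/measurable_EFinP; exact: measurableT_comp.
  - by move=> n t _; rewrite mule_ge0// lee_fin.
  - move=> t _ a b ab; rewrite lee_wpmul2r// lee_fin//.
    exact/lefP/nd_nnsfun_approx.
rewrite !lim_int//; congr (limn _); apply/funext => n.
rewrite !ge0_integral_comp_sfun//; apply: eq_fsbigr => y _.
by rewrite H12.
Qed.

(** The hypothesis says that the conditional mean of [G] given [Z] is 0. Positive and negative parts
    of [f] and [G] reduce the claim to the nonnegative case; all four products are dominated by the
    one integrable product [f (Z t) * G t], so neither factor has to be bounded. *)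
Lemma Rintegral_comp_eq0 (G : T -> R) (f : U -> R) :
  mu.-integrable setT (EFin \o G) -> measurable_fun setT f ->
  mu.-integrable setT (EFin \o (fun t => f (Z t) * G t)) ->
  (forall A, measurable A -> \int[mu]_(t in Z @^-1` A) G t = 0) ->
  \int[mu]_t (f (Z t) * G t) = 0.
Proof.
move=> iG mf ifG G0.
have mG : measurable_fun setT G.
  by apply/measurable_EFinP; exact: measurable_int iG.
have mGp : measurable_fun setT G^\+ by exact: measurable_funrpos.
have mGn : measurable_fun setT G^\- by exact: measurable_funrneg.
have iGp : mu.-integrable setT (EFin \o G^\+) by exact: integrable_funrpos.
have iGn : mu.-integrable setT (EFin \o G^\-) by exact: integrable_funrneg.
have mZA A : measurable A -> measurable (Z @^-1` A).
  by move=> mA; rewrite -[X in measurable X]setTI; exact: mZ.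
have Gpn A : measurable A ->
    (\int[mu]_(t in Z @^-1` A) (G^\+ t)%:E = \int[mu]_(t in Z @^-1` A) (G^\- t)%:E)%E.
  move=> mA.
  have iGpA : mu.-integrable (Z @^-1` A) (EFin \o G^\+).
    by apply: integrableS iGp => //; exact: mZA.
  have iGnA : mu.-integrable (Z @^-1` A) (EFin \o G^\-).
    by apply: integrableS iGn => //; exact: mZA.
  have : \int[mu]_(t in Z @^-1` A) (G^\+ t - G^\- t) = 0.
    rewrite -[RHS](G0 _ mA); apply: eq_Rintegral => t _.
    by rewrite -[in RHS](funrposBneg G).
  rewrite RintegralB//; last exact: mZA.
  move=> /eqP; rewrite subr_eq0 => /eqP; rewrite /Rintegral => e.
  rewrite -[LHS]fineK ?e ?fineK//; apply: integrable_fin_num => //; exact: mZA.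
have mfp : measurable_fun setT f^\+ by exact: measurable_funrpos.
have mfn : measurable_fun setT f^\- by exact: measurable_funrneg.
have mcomp (g : U -> R) : measurable_fun setT g ->
  measurable_fun setT (g \o Z) by move=> ?; exact: measurableT_comp.
have bound (g : U -> R) (K : T -> R) : measurable_fun setT g ->
    measurable_fun setT K ->
    (forall u, 0 <= g u <= `|f u|) -> (forall t, 0 <= K t <= `|G t|) ->
    mu.-integrable setT (EFin \o (fun t => g (Z t) * K t)).
  move=> mg mK g0 K0; apply: le_integrable ifG => //.
    by apply/measurable_EFinP; apply: measurable_funM => //; exact: mcomp.
  move=> t _ /=; rewrite lee_fin !normrM.
  have /andP[? ?] := g0 (Z t); have /andP[? ?] := K0 t.
  by rewrite ler_pM// ger0_norm.
have pos_bnd (V : Type) (k : V -> R) v : 0 <= k^\+ v <= `|k v|.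
  rewrite funrpos_ge0 /funrpos /= ge_max normr_ge0 ler_norm//.
have neg_bnd (V : Type) (k : V -> R) v : 0 <= k^\- v <= `|k v|.
  by rewrite funrneg_ge0 /funrneg /= ge_max normr_ge0 -normrN ler_norm.
have eqpn (g : U -> R) : measurable_fun setT g -> (forall u, 0 <= g u) ->
    \int[mu]_t (g (Z t) * G^\+ t) = \int[mu]_t (g (Z t) * G^\- t).
  move=> mg g0; congr fine.
  have := ge0_integral_comp_eq mGp (funrpos_ge0 G) mGn (funrneg_ge0 G) Gpn mg g0.
  by under eq_integral do rewrite -EFinM; under [RHS]eq_integral do rewrite -EFinM.
have part (g : U -> R) : measurable_fun setT g -> (forall u, 0 <= g u <= `|f u|) ->
    \int[mu]_t (g (Z t) * G t) = 0 /\
    mu.-integrable setT (EFin \o (fun t => g (Z t) * G t)).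
  move=> mg g0.
  have -> : (fun t => g (Z t) * G t) =
      (fun t => g (Z t) * G^\+ t - g (Z t) * G^\- t).
    by apply/funext => t; rewrite -mulrBr -[in LHS](funrposBneg G).
  split.
    rewrite RintegralB//; try by apply: bound.
    by rewrite eqpn ?subrr// => u; have /andP[] := g0 u.
  exact: (integrableB measurableT (bound _ _ mg mGp g0 (pos_bnd _ G))
                                  (bound _ _ mg mGn g0 (neg_bnd _ G))).
have [p1 p2] := part _ mfp (pos_bnd _ f).
have [n1 n2] := part _ mfn (neg_bnd _ f).
transitivity (\int[mu]_t (f^\+ (Z t) * G t - f^\- (Z t) * G t)).
  by apply: eq_Rintegral => t _; rewrite -mulrBl -[in LHS](funrposBneg f).
by rewrite RintegralB// p1 n1 subr0.
Qed.

End integral_composition.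

Lemma trivIset_preimage {T U : Type} (Z : T -> U) (F : (set U)^nat) :
  trivIset setT F -> trivIset setT (fun n => Z @^-1` F n).
Proof.
move=> tF; apply/trivIsetP => i j _ _ ij; rewrite -preimage_setI.
by have /trivIsetP/(_ _ _ I I ij) -> := tF; rewrite preimage_set0.
Qed.

(** * Equality of laws, and extension from rectangles to all measurable sets *)

Section image_law.
Context {d d' : measure_display} {T : measurableType d} {U : measurableType d'}.
Context {R : realType} (mu : {measure set T -> \bar R}).
Local Open Scope ereal_scope.

(** Integrability is not assumed: the integral is the difference of the integrals of the two parts,
    and each part is transported separately. *)
Lemma integral_image_law (Z : T -> U) (nu : {measure set U -> \bar R})
    (f : U -> \bar R) :
  measurable_fun setT Z ->
  (forall S, measurable S -> mu (Z @^-1` S) = nu S) ->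
  measurable_fun setT f ->
  \int[mu]_t f (Z t) = \int[nu]_u f u.
Proof.
move=> mZ Znu mf.
have pos (g : U -> \bar R) : measurable_fun setT g -> (forall u, 0 <= g u) ->
    \int[mu]_t g (Z t) = \int[nu]_u g u.
  move=> mg g0.
  have /esym := @ge0_integral_pushforward _ _ _ _ R _ mZ mu setT g measurableT mg
    (fun u _ => g0 u).
  rewrite preimage_setT => ->; apply: eq_measure_integral => S mS _.
  exact: Znu.
rewrite integralE [RHS]integralE; congr (_ - _).
  rewrite -(pos f^\+ (measurable_funepos mf) (funepos_ge0 f)).
  by apply: eq_integral => t _; rewrite !unlock.
rewrite -(pos f^\- (measurable_funeneg mf) (funeneg_ge0 f)).
by apply: eq_integral => t _; rewrite !unlock.
Qed.

End image_law.

Section rectangles.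
Context {d d1 d2 : measure_display}.
Context {T : measurableType d} {U1 : measurableType d1} {U2 : measurableType d2}.
Context {R : realType}.

(** The pi-lambda theorem: rectangles are stable under intersection and generate the product
    sigma-algebra. *)
Lemma rectangle_induction (Q : set_system (U1 * U2)) :
  (forall A B, measurable A -> measurable B -> Q (A `*` B)) ->
  (forall S, measurable S -> Q S -> Q (~` S)) ->
  (forall F : (set (U1 * U2))^nat, (forall n, measurable (F n)) ->
    trivIset setT F -> (forall n, Q (F n)) -> Q (\bigcup_k F k)) ->
  forall S, measurable S -> Q S.
Proof.
move=> Qrect QC Qbig; rewrite measurable_prod_measurableType.
apply: dynkin_induction => //.
- by rewrite measurable_prod_measurableType.
- move=> _ _ [A1 mA1 [A2 mA2 <-]] [B1 mB1 [B2 mB2 <-]].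
  exists (A1 `&` B1); first exact: measurableI.
  by exists (A2 `&` B2); [exact: measurableI|rewrite setXI].
- by rewrite -setXTT; exact: Qrect.
- by move=> _ [A mA [B mB <-]]; exact: Qrect.
Qed.

(** The sets over which [G] integrates to 0 form a Dynkin class: the whole space is a rectangle, so
    complements follow by subtraction, and integrability of [G] gives countable additivity. *)
Lemma Rintegral_preimage_eq0 (mu : {measure set T -> \bar R})
    (Z : T -> U1 * U2) (G : T -> R) :
  measurable_fun setT Z -> mu.-integrable setT (EFin \o G) ->
  (forall A B, measurable A -> measurable B ->
    \int[mu]_(t in Z @^-1` (A `*` B)) G t = 0) ->
  forall S, measurable S -> \int[mu]_(t in Z @^-1` S) G t = 0.
Proof.
move=> mZ iG Grect.
have mZA S : measurable S -> measurable (Z @^-1` S).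
  by move=> mS; rewrite -[X in measurable X]setTI; exact: mZ.
have GT : \int[mu]_t G t = 0.
  by rewrite -[RHS](Grect setT setT)// setXTT preimage_setT.
apply: rectangle_induction => // [S mS QS|F mF tF QF].
- have := @Rintegral_setU _ _ _ mu (Z @^-1` S) (Z @^-1` (~` S)) G.
  rewrite -preimage_setU setUv preimage_setT GT QS add0r => <- //.
  + exact: mZA.
  + by apply: mZA; exact: measurableC.
  + by apply/disj_setPS => t [].
- rewrite preimage_bigcup /Rintegral integral_bigcup.
  + rewrite eseries0// => n _ _; rewrite -[LHS]fineK.
      by congr EFin; exact: QF.
    apply: integrable_fin_num; first exact: mZA.
    by apply: integrableS iG => //; exact: mZA.
  + exact: trivIset_preimage.
  + by move=> n; exact: mZA.
  + apply: integrableS iG => //.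
    by apply: bigcup_measurable => n _; exact: mZA.
Qed.

Lemma eq_law_rectangles (P : probability T R) (Z Z' : T -> U1 * U2) :
  measurable_fun setT Z -> measurable_fun setT Z' ->
  (forall A B, measurable A -> measurable B ->
    P (Z @^-1` (A `*` B)) = P (Z' @^-1` (A `*` B))) ->
  forall S, measurable S -> P (Z @^-1` S) = P (Z' @^-1` S).
Proof.
move=> mZ mZ' eqr.
have mZA S : measurable S -> measurable (Z @^-1` S).
  by move=> mS; rewrite -[X in measurable X]setTI; exact: mZ.
have mZA' S : measurable S -> measurable (Z' @^-1` S).
  by move=> mS; rewrite -[X in measurable X]setTI; exact: mZ'.
apply: rectangle_induction => // [S mS QS|F mF tF QF].
- rewrite -!preimage_setC (probability_setC _ (mZA _ mS)).
  by rewrite (probability_setC _ (mZA' _ mS)) QS.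
- rewrite !preimage_bigcup !measure_bigcup//.
  + by apply: eq_eseriesr => n _; exact: QF.
  all: by [exact: trivIset_preimage|move=> n _; auto].
Qed.

End rectangles.

(** * Independence *)

Lemma Rintegral_sum {d : measure_display} {T : measurableType d} {R : realType}
    (mu : {measure set T -> \bar R}) (D : set T) (I : Type) (s : seq I)
    (f : I -> T -> R) :
  measurable D -> (forall i, mu.-integrable D (EFin \o f i)) ->
  \int[mu]_(t in D) (\sum_(i <- s) f i t) = \sum_(i <- s) \int[mu]_(t in D) f i t.
Proof.
move=> mD intf; rewrite /Rintegral.
under eq_integral do rewrite -sumEFin.
rewrite integral_sum//.
rewrite -[RHS]/(fine (\sum_(i <- s) fine (\int[mu]_(t in D) (f i t)%:E))%:E).
rewrite -sumEFin; congr fine; apply: eq_bigr => i _.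
by rewrite fineK//; exact: (integrable_fin_num mD (intf i)).
Qed.

Section probability_integrals.
Context {d : measure_display} {T : measurableType d} {R : realType}.
Variable P : probability T R.

Lemma bounded_integrable (f : T -> R) :
  measurable_fun setT f -> (exists M, forall t, `|f t| <= M) ->
  P.-integrable setT (EFin \o f).
Proof.
move=> mf [M fM]; apply: measurable_bounded_integrable => //.
  by rewrite (le_lt_trans (probability_le1 P measurableT))// ltry.
exists M; split; first by rewrite num_real.
by move=> m Mm t _ /=; rewrite (le_trans (fM t))// ltW.
Qed.

Lemma Rintegral_indicM (A : set T) (G : T -> R) :
  \int[P]_(t in A) G t = \int[P]_t (\1_A t * G t).
Proof.
rewrite Rintegral_mkcond; apply: eq_Rintegral => t _.
by rewrite patch_indic mulrC.
Qed.

Lemma Rintegral_indic (A : set T) : measurable A ->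
  \int[P]_t (\1_A t : R) = fine (P A).
Proof. by move=> mA; rewrite /Rintegral integral_indic// setIT. Qed.

Lemma Rintegral_cstT (c : R) : \int[P]_t c = c.
Proof.
rewrite Rintegral_cst//.
by have := @probability_setT _ _ _ P => /= ->; rewrite mulr1.
Qed.

End probability_integrals.

Section product_rule.
Context {d d' : measure_display} {T : measurableType d} {U : measurableType d'}.
Context {R : realType}.
Variables (P : probability T R) (n : nat) (Z : 'I_n -> T -> U).
Hypothesis mZ : forall i, measurable_fun setT (Z i).
Hypothesis indepZ : forall A : 'I_n -> set U, (forall i, measurable (A i)) ->
  P (\bigcap_(i in [set: 'I_n]) (Z i @^-1` A i)) =
  (\big[*%E/1%E]_(i < n) P (Z i @^-1` A i))%E.

Let mZA i (A : set U) : measurable A -> measurable (Z i @^-1` A).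
Proof. by move=> mA; rewrite -[X in measurable X]setTI; exact: mZ. Qed.

Lemma prod_indicator (A : 'I_n -> set U) t :
  \prod_i (\1_(A i) (Z i t) : R) = \1_(\bigcap_(i in [set: 'I_n]) (Z i @^-1` A i)) t.
Proof.
rewrite indicE; case: (asboolP (forall i, A i (Z i t))) => [At|nAt].
  rewrite mem_set; last by move=> i _; exact: At.
  by rewrite big1// => i _; rewrite indicE mem_set//; exact: At.
have /existsNP[i Ait] := nAt.
rewrite memNset; last by move=> /(_ i I).
by rewrite (bigD1 i)//= indicE memNset// mul0r.
Qed.

Lemma Rintegral_prod_indicator (A : 'I_n -> set U) :
  (forall i, measurable (A i)) ->
  \int[P]_t (\prod_i \1_(A i) (Z i t)) = \prod_i \int[P]_t \1_(A i) (Z i t).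
Proof.
move=> mA; under eq_Rintegral do rewrite prod_indicator.
rewrite Rintegral_indic; last first.
  by apply: fin_bigcap_measurable => // i _; exact: mZA.
transitivity (fine (\prod_(i < n) fine (P (Z i @^-1` A i)))%:E).
  rewrite indepZ// -prodEFin; congr fine; apply: eq_bigr => i _.
  by rewrite fineK//; apply: fin_num_measure; exact: mZA.
rewrite /=; apply: eq_bigr => i _.
by rewrite -Rintegral_indic//; exact: mZA.
Qed.

Lemma bounded_prod (h : 'I_n -> U -> R) (Q : pred 'I_n) :
  (forall i, exists M, forall u, `|h i u| <= M) ->
  exists M, forall t, `|\prod_(i | Q i) h i (Z i t)| <= M.
Proof.
move=> /choice[M hM]; exists (\prod_(i | Q i) M i) => t.
by rewrite normr_prod; apply: ler_prod => i _; rewrite normr_ge0 hM.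
Qed.

Lemma measurable_prod_comp (h : 'I_n -> U -> R) (Q : pred 'I_n) :
  (forall i, measurable_fun setT (h i)) ->
  measurable_fun setT (fun t => \prod_(i | Q i) h i (Z i t)).
Proof.
move=> mh; under eq_fun do rewrite -big_filter.
by apply: measurable_prod => i _; exact: measurableT_comp.
Qed.

Lemma Rintegral_prod (h : 'I_n -> U -> R) :
  (forall i, measurable_fun setT (h i)) ->
  (forall i, exists M, forall u, `|h i u| <= M) ->
  \int[P]_t (\prod_i h i (Z i t)) = \prod_i \int[P]_t h i (Z i t).
Proof.
move=> mh bh.
(* the factors are turned one by one from indicators into bounded functions *)
have step k : forall h : 'I_n -> U -> R,
    (forall i, measurable_fun setT (h i)) ->
    (forall i, exists M, forall u, `|h i u| <= M) ->
    (forall i : 'I_n, (k <= i)%N -> exists2 A, measurable A & h i = \1_A) ->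
    \int[P]_t (\prod_i h i (Z i t)) = \prod_i \int[P]_t h i (Z i t).
  elim: k => [|k IH] {mh bh}h mh bh indh.
    have /choice[A hA] : forall i, exists A, measurable A /\ h i = \1_A.
      by move=> i; have [A mA ->] := indh i (leq0n _); exists A.
    under eq_Rintegral do under eq_bigr do rewrite (hA _).2.
    rewrite Rintegral_prod_indicator; last by move=> i; exact: (hA i).1.
    by apply: eq_bigr => i _; rewrite (hA i).2.
  (* If [n <= k], no index reaches [k], and the indicator condition of the induction hypothesis is
     vacuous. *)
  have [nk|kn] := leqP n k.
    by apply: IH => // i ki; have := leq_trans (ltn_ord i) (leq_trans nk ki);
      rewrite ltnn.
  pose i0 := Ordinal kn.
  pose c := \prod_(i | i != i0) \int[P]_t h i (Z i t).
  (* Subtracting [c], the product of the other means, makes this integrate to 0 over every event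
     determined by [Z i0]: with factor [i0] replaced by an indicator, the induction hypothesis
     applies. Orthogonality to [h i0 (Z i0 t)] then follows. *)
  pose G t := \prod_(i | i != i0) h i (Z i t) - c.
  have mG : measurable_fun setT G.
    by apply: measurable_funB => //; exact: measurable_prod_comp.
  have [MG bG] := bounded_prod (fun i => i != i0) bh.
  have bG' t : `|G t| <= MG + `|c|.
    by rewrite (le_trans (ler_normB _ _))// lerD2r.
  have [M0 b0] := bh i0.
  have mh0 : measurable_fun setT (h i0 \o Z i0) by exact: measurableT_comp.
  have iG : P.-integrable setT (EFin \o G).
    by apply: bounded_integrable => //; exists (MG + `|c|).
  have ihG : P.-integrable setT (EFin \o (fun t => h i0 (Z i0 t) * G t)).
    apply: bounded_integrable; first exact: measurable_funM.
    by exists (M0 * (MG + `|c|)) => t; rewrite normrM ler_pM.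
  have G0 A : measurable A -> \int[P]_(t in Z i0 @^-1` A) G t = 0.
    move=> mA.
    have [h' [h'0 h'h]] : exists h' : 'I_n -> U -> R,
        h' i0 = \1_A /\ (forall i, i != i0 -> h' i = h i).
      exists (fun i => if i == i0 then \1_A else h i).
      by rewrite eqxx; split=> // i /negPf ->.
    have mh' i : measurable_fun setT (h' i).
      by have [->|ii0] := eqVneq i i0; [rewrite h'0|rewrite h'h].
    have bh' i : exists M, forall u, `|h' i u| <= M.
      have [->|ii0] := eqVneq i i0; last by rewrite h'h.
      rewrite h'0; exists 1 => u.
      by rewrite indicE; case: (_ \in _); rewrite ?normr1 ?normr0.
    have indh' : forall i : 'I_n, (k <= i)%N ->
        exists2 A0, measurable A0 & h' i = \1_A0.
      move=> i ki; have [->|ii0] := eqVneq i i0; first by exists A.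
      rewrite h'h//; apply: indh; rewrite ltn_neqAle ki andbT.
      by apply: contra ii0 => /eqP e; apply/eqP/val_inj.
    have Eh' : \int[P]_t (\1_A (Z i0 t) * \prod_(i | i != i0) h i (Z i t)) =
        \int[P]_t \1_A (Z i0 t) * c.
      have := IH h' mh' bh' indh'; rewrite (bigD1 i0)//= h'0.
      under [X in _ = _ * X]eq_bigr => i ii0 do rewrite h'h//.
      move=> <-; apply: eq_Rintegral => t _; rewrite [RHS](bigD1 i0)//= h'0.
      by congr (_ * _); apply: eq_bigr => i ii0; rewrite h'h.
    have mIA : measurable_fun setT (\1_A \o Z i0 : T -> R).
      by apply: measurableT_comp => //; exact: measurable_indic.
    have bIA t : `|\1_A (Z i0 t) : R| <= 1.
      by rewrite indicE; case: (_ \in _); rewrite ?normr1 ?normr0.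
    rewrite Rintegral_indicM.
    transitivity (\int[P]_t (\1_A (Z i0 t) * \prod_(i | i != i0) h i (Z i t)
        - \1_A (Z i0 t) * c)).
      by apply: eq_Rintegral => t _; rewrite -mulrBr.
    rewrite RintegralB//; last 2 first.
    - apply: bounded_integrable.
        by apply: measurable_funM => //; exact: measurable_prod_comp.
      by exists (1 * MG) => t; rewrite normrM ler_pM.
    - apply: bounded_integrable; first exact: measurable_funM.
      by exists (1 * `|c|) => t; rewrite normrM ler_pM.
    rewrite Eh' RintegralZr ?subrr//.
    by apply: bounded_integrable => //; exists 1.
  have E0 := Rintegral_comp_eq0 (mZ i0) iG (mh i0) ihG G0.
  rewrite [RHS](bigD1 i0)//= -/c.
  transitivity (\int[P]_t (h i0 (Z i0 t) * G t + h i0 (Z i0 t) * c)).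
    by apply: eq_Rintegral => t _; rewrite (bigD1 i0)//= -mulrDr subrK.
  rewrite RintegralD//; last first.
    apply: bounded_integrable; first exact: measurable_funM.
    by exists (M0 * `|c|) => t; rewrite normrM ler_pM.
  rewrite E0 add0r RintegralZr//.
  by apply: bounded_integrable => //; exists M0.
by apply: (step n) => // i; rewrite leqNgt ltn_ord.
Qed.

End product_rule.

Section uncorrelated.
Context {d d1 d2 d1' d2' : measure_display} {T : measurableType d}.
Context {U1 : measurableType d1} {U2 : measurableType d2}.
Context {V1 : measurableType d1'} {V2 : measurableType d2'} {R : realType}.
Variables (P : probability T R) (W : T -> U1 * U2) (W' : T -> V1 * V2).
Hypothesis mW : measurable_fun setT W.
Hypothesis mW' : measurable_fun setT W'.
Hypothesis indepW : forall A B A' B',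
  measurable A -> measurable B -> measurable A' -> measurable B' ->
  P (W @^-1` (A `*` B) `&` W' @^-1` (A' `*` B')) =
  (P (W @^-1` (A `*` B)) * P (W' @^-1` (A' `*` B')))%E.

(** Orthogonality to functions of a variable is invoked twice. The centred indicator of a
    [W']-rectangle integrates to 0 over all events of [W], hence is orthogonal to [g (W t)]. So
    [g (W t)], having mean 0, integrates to 0 over [W']-rectangles, then over all events of [W'],
    and is orthogonal to [g' (W' t)]. Truncation of the unbounded [g] is thus avoided. *)
Lemma Rintegral_indep_mul_eq0 (g : U1 * U2 -> R) (g' : V1 * V2 -> R) :
  measurable_fun setT g -> measurable_fun setT g' ->
  P.-integrable setT (EFin \o (g \o W)) ->
  P.-integrable setT (EFin \o (fun t => g' (W' t) * g (W t))) ->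
  \int[P]_t g (W t) = 0 ->
  \int[P]_t (g' (W' t) * g (W t)) = 0.
Proof.
move=> mg mg' ig igg' g0.
have mWA S : measurable S -> measurable (W @^-1` S).
  by move=> mS; rewrite -[X in measurable X]setTI; exact: mW.
have mWA' S : measurable S -> measurable (W' @^-1` S).
  by move=> mS; rewrite -[X in measurable X]setTI; exact: mW'.
have mgW : measurable_fun setT (g \o W) by exact: measurableT_comp.
apply: (@Rintegral_comp_eq0 _ _ _ _ _ P W' mW' (g \o W)) => //.
apply: Rintegral_preimage_eq0 => // A' B' mA' mB'.
set S' := W' @^-1` (A' `*` B').
have mS' : measurable S' by apply: mWA'; exact: measurableX.
have ind_le1 (S : set T) t : `|\1_S t : R| <= 1.
  by rewrite indicE; case: (_ \in _); rewrite ?normr1 ?normr0.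
have iind (S : set T) : measurable S -> P.-integrable setT (EFin \o \1_S).
  by move=> mS; apply: bounded_integrable; [exact: measurable_indic|exists 1].
pose G t : R := \1_S' t - fine (P S').
have mG : measurable_fun setT G.
  by apply: measurable_funB => //; exact: measurable_indic.
have bG t : `|G t| <= 1 + `|fine (P S')|.
  by rewrite (le_trans (ler_normB _ _))// lerD2r.
have iG : P.-integrable setT (EFin \o G).
  by apply: bounded_integrable => //; exists (1 + `|fine (P S')|).
have igi : P.-integrable setT (EFin \o (fun t => g (W t) * \1_S' t)).
  apply: le_integrable ig => //.
    by apply/measurable_EFinP/measurable_funM => //; exact: measurable_indic.
  by move=> t _ /=; rewrite lee_fin normrM ler_piMr.
have igG : P.-integrable setT (EFin \o (fun t => g (W t) * G t)).
  apply: le_integrable (integrableZl measurableT (1 + `|fine (P S')|) ig) => //.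
    by apply/measurable_EFinP/measurable_funM.
  move=> t _ /=; rewrite lee_fin mulrC !normrM ler_wpM2r//.
  by rewrite (le_trans (bG t))// ler_norm.
have G0 S : measurable S -> \int[P]_(t in W @^-1` S) G t = 0.
  apply: Rintegral_preimage_eq0 => // A B mA mB.
  set S1 := W @^-1` (A `*` B).
  have mS1 : measurable S1 by apply: mWA; exact: measurableX.
  rewrite Rintegral_indicM.
  transitivity (\int[P]_t (\1_(S1 `&` S') t - \1_S1 t * fine (P S'))).
    by apply: eq_Rintegral => t _; rewrite mulrBr indicI.
  rewrite RintegralB//; last 2 first.
  - by apply: iind; exact: measurableI.
  - apply: bounded_integrable.
      by apply: measurable_funM => //; exact: measurable_indic.
    by exists (1 * `|fine (P S')|) => t; rewrite normrM ler_pM.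
  rewrite RintegralZr//; last exact: iind.
  rewrite !Rintegral_indic//; last exact: measurableI.
  rewrite [P _]indepW// fineM ?subrr//; exact: fin_num_measure.
rewrite Rintegral_indicM.
have := Rintegral_comp_eq0 mW iG mg igG G0.
have -> : (fun t => g (W t) * G t) =
    (fun t => g (W t) * \1_S' t - g (W t) * fine (P S')).
  by apply/funext => t; rewrite mulrBr.
rewrite RintegralB//; last exact: (integrableZr measurableT (fine (P S')) ig).
rewrite RintegralZr// g0 mul0r subr0 => <-.
by apply: eq_Rintegral => t _; rewrite mulrC.
Qed.

End uncorrelated.

(** * Exponential tail bound for sums of bounded centred independent variables *)

Lemma expR_le_quadratic {R : realType} (u : R) :
  `|u| <= 1 / 2 -> expR u <= 1 + u + 2 * u ^+ 2.
Proof.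
rewrite ler_norml => /andP[u1 u2].
have u0 : 0 < 1 - u by lra.
(* This is [1 - u <= expR (- u)] rearranged. It remains to see that (1 - u)(1 + u + 2u^2) = 1 + u^2
   (1 - 2u) is at least 1, which holds as u <= 1/2. *)
have : expR u * (1 - u) <= 1.
  rewrite -ler_pdivlMl ?expR_gt0// mulr1 -expRN.
  exact: expR_ge1Dx.
rewrite -ler_pdivlMr// => /le_trans; apply.
rewrite ler_pdivrMr//; nra.
Qed.

Section bernstein.
Context {d d' : measure_display} {T : measurableType d} {U : measurableType d'}.
Context {R : realType}.
Variables (P : probability T R) (n : nat) (Z : 'I_n -> T -> U).
Hypothesis mZ : forall i, measurable_fun setT (Z i).
Hypothesis indepZ : forall A : 'I_n -> set U, (forall i, measurable (A i)) ->
  P (\bigcap_(i in [set: 'I_n]) (Z i @^-1` A i)) =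
  (\big[*%E/1%E]_(i < n) P (Z i @^-1` A i))%E.
Variables (g : U -> R) (b : R).
Hypothesis mg : measurable_fun setT g.
Hypothesis b_gt0 : 0 < b.
Hypothesis gb : forall u, `|g u| <= b.
Hypothesis g0 : forall i, \int[P]_t g (Z i t) = 0.

Lemma mgf_bound (lam : R) : 0 <= lam -> lam * b <= 1 / 2 ->
  \int[P]_t expR (lam * \sum_i g (Z i t)) <= expR (n%:R * (2 * (lam * b) ^+ 2)).
Proof.
move=> l0 lb1.
have mgZ i : measurable_fun setT (fun t => g (Z i t)).
  exact: measurableT_comp.
have mlg i : measurable_fun setT (fun t => lam * g (Z i t)).
  exact: measurable_funM.
have glam u : `|lam * g u| <= lam * b.
  by rewrite normrM (ger0_norm l0) ler_wpM2l.
under eq_Rintegral do rewrite mulr_sumr expR_sum.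
rewrite (@Rintegral_prod _ _ _ _ _ P n Z mZ indepZ
  (fun _ u => expR (lam * g u))); last 2 first.
- move=> _; apply: measurableT_comp => //; exact: measurable_funM.
- move=> _; exists (expR (lam * b)) => u.
  by rewrite ger0_norm ?expR_ge0// ler_expR (le_trans (ler_norm _)).
rewrite expRM_natl -[in leRHS](card_ord n) -prodr_const.
apply: ler_prod => i _; apply/andP; split.
  by apply: Rintegral_ge0 => t _; exact: expR_ge0.
(* In the quadratic bound for each factor the linear term has mean 0, and the square is bounded
   through [gb]. *)
apply: (@le_trans _ _ (1 + 2 * (lam * b) ^+ 2)); last exact: expR_ge1Dx.
have iexp : P.-integrable setT (EFin \o (fun t => expR (lam * g (Z i t)))).
  apply: bounded_integrable.
    exact: measurableT_comp.
  exists (expR (lam * b)) => t.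
  by rewrite ger0_norm ?expR_ge0// ler_expR (le_trans (ler_norm _)).
have ig : P.-integrable setT (EFin \o (fun t => g (Z i t))).
  by apply: bounded_integrable => //; exists b => t; exact: gb.
have ilin : P.-integrable setT (EFin \o (fun t => lam * g (Z i t))).
  by apply: bounded_integrable => //; exists (lam * b).
have icst c : P.-integrable setT (EFin \o (fun=> c)).
  by apply: bounded_integrable => //; exists `|c|.
apply: (@le_trans _ _ (\int[P]_t ((1 + 2 * (lam * b) ^+ 2) + lam * g (Z i t)))).
  apply: le_Rintegral => //.
    apply: bounded_integrable.
      exact: measurable_funD.
    exists (`|1 + 2 * (lam * b) ^+ 2| + lam * b) => t.
    by rewrite (le_trans (ler_normD _ _))// lerD2l.
  move=> t _; apply: (le_trans (expR_le_quadratic _)).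
    by rewrite (le_trans (glam _)).
  rewrite addrAC lerD2r lerD2l ler_pM2l// -[leLHS]real_normK ?num_real//.
  by rewrite ler_pXn2r ?nnegrE// mulr_ge0// ltW.
by rewrite RintegralD// Rintegral_cstT RintegralZl// g0 mulr0 addr0.
Qed.

Lemma tail_bound (s : R) : 0 < s -> s <= 2 * b ->
  (P [set t | (s * n%:R <= \sum_i g (Z i t))%R] <=
   (expR (- (n%:R * s ^+ 2 / (8 * b ^+ 2))))%:E)%E.
Proof.
move=> s0 sb.
(* The minimiser of 2 lam^2 b^2 - lam s, with minimum - s^2 / (8 b^2). The assumption [s <= 2 * b]
   is exactly [lam * b <= 1 / 2]. *)
pose lam := s / (4 * b ^+ 2).
have lam0 : 0 < lam by rewrite divr_gt0 ?mulr_gt0 ?exprn_gt0.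
have lamb : lam * b <= 1 / 2.
  have -> : lam * b = s / (4 * b) by rewrite /lam; field; rewrite gt_eqF.
  by rewrite ler_pdivrMr ?mulr_gt0//; lra.
have mS : measurable_fun setT (fun t => \sum_i g (Z i t)).
  by apply: measurable_sum => i; exact: measurableT_comp.
pose mS_mixin := isMeasurableFun.Build _ _ _ _ _ mS.
pose S : {mfun T >-> R} := HB.pack (fun t => \sum_i g (Z i t)) mS_mixin.
apply: (le_trans (@chernoff _ _ _ P S lam (s * n%:R) lam0)).
rewrite /mmt_gen_fun unlock.
have -> : (\int[P]_w ((expR \o lam \o* S) w)%:E)%E =
    (\int[P]_t expR (lam * \sum_i g (Z i t)))%:E.
  rewrite /Rintegral fineK.
    by apply: eq_integral => t _; rewrite /= mulrC.
  apply: integrable_fin_num => //; apply: bounded_integrable.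
    by apply: measurableT_comp => //; exact: measurable_funM.
  exists (expR (lam * \sum_(i < n) b)) => t.
  rewrite ger0_norm ?expR_ge0// ler_expR ler_wpM2l ?(ltW lam0)//.
  by apply: ler_sum => i _; rewrite (le_trans (ler_norm _)).
rewrite -EFinM lee_fin.
apply: le_trans (ler_wpM2r (expR_ge0 _) (mgf_bound (ltW lam0) lamb)) _.
rewrite -expRD ler_expR le_eqVlt; apply/orP; left; apply/eqP.
by rewrite /lam; field; rewrite gt_eqF.
Qed.

End bernstein.

(** * The Fourier system *)

Section fourier.
Context {R : realType}.
Implicit Types (w x : R) (j k m : nat).
Local Notation mu := (@lebesgue_measure R).

Lemma period_gt0 : 0 < 2 * pi :> R.
Proof. by rewrite mulr_gt0// pi_gt0. Qed.

Lemma cos_nat_period m : cos (m%:R * (2 * pi)) = 1 :> R.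
Proof.
have := periodicn (@cosD2pi R) m 0.
by rewrite add0r cos0 mulr_natl mulr2n mulr_natl -mulr2n.
Qed.

Lemma sin_nat_period m : sin (m%:R * (2 * pi)) = 0 :> R.
Proof.
have := periodicn (@sinD2pi R) m 0.
by rewrite add0r sin0 mulr_natl mulr2n mulr_natl -mulr2n.
Qed.

Lemma Rintegral_continuous_FTC2 (f F : R -> R) (a b : R) :
  a < b -> continuous f -> (forall x, is_derive x 1 F (f x)) ->
  \int[mu]_(x in `[a, b]) f x = F b - F a.
Proof.
move=> ab cf dF.
have cF : continuous F.
  by move=> x; apply: differentiable_continuous; apply/derivable1_diffP.
rewrite /Rintegral (@continuous_FTC2 _ f F)//.
- by apply: continuous_subspaceT.
- split.
  + by move=> x _.
  + by apply: cvg_at_right_filter; exact: cF.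
  + by apply: cvg_at_left_filter; exact: cF.
- by move=> x _; rewrite derive1E; exact: derive_val.
Qed.

Lemma Rintegral_cosM w : w != 0 ->
  \int[mu]_(x in `[0, 2 * pi]) cos (w * x) = sin (w * (2 * pi)) / w.
Proof.
move=> w0.
have dF (x : R) : is_derive x 1 (fun y : R => w^-1 * sin (w * y)) (cos (w * x)).
  have dl : is_derive x 1 (fun y : R => w * y) w.
    by apply: is_derive_eq; rewrite /GRing.scale/= mulr1.
  have ds := @is_derive1_comp R sin (fun y : R => w * y) x _ _ (is_derive_sin _) dl.
  by apply: is_derive_eq; rewrite /GRing.scale/=; field.
rewrite (Rintegral_continuous_FTC2 period_gt0 _ dF).
  by rewrite mulr0 sin0 mulr0 subr0 mulrC.
move=> x; apply: continuous_comp; last exact: continuous_cos.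
by apply: continuousM; [exact: cvg_cst|exact: cvg_id].
Qed.

Lemma Rintegral_sinM w : w != 0 ->
  \int[mu]_(x in `[0, 2 * pi]) sin (w * x) = (1 - cos (w * (2 * pi))) / w.
Proof.
move=> w0.
have dF (x : R) : is_derive x 1 (fun y : R => - w^-1 * cos (w * y)) (sin (w * x)).
  have dl : is_derive x 1 (fun y : R => w * y) w.
    by apply: is_derive_eq; rewrite /GRing.scale/= mulr1.
  have ds := @is_derive1_comp R cos (fun y : R => w * y) x _ _ (is_derive_cos _) dl.
  by apply: is_derive_eq; rewrite /GRing.scale/=; field.
rewrite (Rintegral_continuous_FTC2 period_gt0 _ dF).
  by rewrite mulr0 cos0; field.
move=> x; apply: continuous_comp; last exact: continuous_sin.
by apply: continuousM; [exact: cvg_cst|exact: cvg_id].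
Qed.

Lemma Rintegral_period_cst (c : R) :
  \int[mu]_(x in `[0, 2 * pi]) c = c * (2 * pi).
Proof.
rewrite Rintegral_cst//= lebesgue_measure_itv/= lte_fin period_gt0.
by rewrite oppr0 addr0.
Qed.

(** Frequencies are signed because the product-to-sum formulas produce the difference of two
    frequencies. *)
Lemma Rintegral_cos_freq (z : int) :
  \int[mu]_(x in `[0, 2 * pi]) cos (z%:~R * x) = (z == 0)%:R * (2 * pi).
Proof.
have [->|z0] := eqVneq z 0.
  rewrite mul1r -[RHS]mul1r -Rintegral_period_cst.
  by apply: eq_Rintegral => x _; rewrite mul0r cos0.
rewrite mul0r Rintegral_cosM ?intr_eq0//.
case: z {z0} => m; first by rewrite sin_nat_period mul0r.
by rewrite NegzE mulrNz mulNr sinN sin_nat_period oppr0 mul0r.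
Qed.

Lemma Rintegral_sin_freq (z : int) :
  \int[mu]_(x in `[0, 2 * pi]) sin (z%:~R * x) = 0.
Proof.
have [->|z0] := eqVneq z 0.
  rewrite -[RHS](mul0r (2 * pi)) -Rintegral_period_cst.
  by apply: eq_Rintegral => x _; rewrite mul0r sin0.
rewrite Rintegral_sinM ?intr_eq0//.
case: z {z0} => m; first by rewrite cos_nat_period subrr mul0r.
by rewrite NegzE mulrNz mulNr cosN cos_nat_period subrr mul0r.
Qed.

Lemma measurable_sinM w : measurable_fun setT (fun x : R => sin (w * x)).
Proof.
apply: continuous_measurable_fun => x.
apply: continuous_comp; last exact: continuous_sin.
by apply: continuousM; [exact: cvg_cst|exact: cvg_id].
Qed.

Lemma measurable_cosM w : measurable_fun setT (fun x : R => cos (w * x)).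
Proof.
apply: continuous_measurable_fun => x.
apply: continuous_comp; last exact: continuous_cos.
by apply: continuousM; [exact: cvg_cst|exact: cvg_id].
Qed.

Lemma period_integrable (f : R -> R) :
  measurable_fun setT f -> (exists M, forall x, `|f x| <= M) ->
  mu.-integrable `[0, 2 * pi] (EFin \o f).
Proof.
move=> mf [M fM]; apply: measurable_bounded_integrable => //.
- by rewrite /= lebesgue_measure_itv/= lte_fin period_gt0 -EFinB ltry.
- exact: measurable_funTS.
- exists M; split; first by rewrite num_real.
  by move=> m Mm t _ /=; rewrite (le_trans (fM t))// ltW.
Qed.

(** With [phi_isin], this puts the constant function among the cosines: at k = 1 the frequency
    [k./2] is 0. *)
Definition phi_amp k : R := if k == 1%N then 1 else Num.sqrt 2.
Definition phi_isin k := odd k && (k != 1%N).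

Lemma phiE k x : (0 < k)%N ->
  phi k x = phi_amp k * (if phi_isin k then sin ((k./2)%:R * x) else cos ((k./2)%:R * x)).
Proof.
case: k => [//|[|k]] _; rewrite /phi_amp /phi_isin /=.
  by rewrite mul0r cos0 mulr1.
by rewrite negbK andbT; case: odd.
Qed.

Lemma measurable_phi k : measurable_fun setT (@phi R k).
Proof.
case: k => [|k]; first exact: measurable_cst.
have -> : @phi R k.+1 = (fun x => phi_amp k.+1 * (if phi_isin k.+1
    then sin ((k.+1)./2%:R * x) else cos ((k.+1)./2%:R * x))).
  by apply/funext => x; exact: phiE.
by apply: measurable_funM => //; case: (phi_isin k.+1);
  [exact: measurable_sinM|exact: measurable_cosM].
Qed.

Lemma phi_sqr_le2 k x : phi k x ^+ 2 <= 2.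
Proof.
case: k => [|k]; first by rewrite expr0n.
rewrite phiE// exprMn.
have a2 : phi_amp k.+1 ^+ 2 <= 2.
  by rewrite /phi_amp; case: ifP => _; rewrite ?sqr_sqrtr// expr1n ler1n.
rewrite -[leRHS]mulr1 ler_pM ?sqr_ge0//.
have := cos2Dsin2 ((k.+1)./2%:R * x).
have := sqr_ge0 (cos ((k.+1)./2%:R * x)).
have := sqr_ge0 (sin ((k.+1)./2%:R * x)).
by case: ifP => _; lra.
Qed.

Lemma normr_phi_le2 k x : `|phi k x| <= 2.
Proof.
rewrite -(@ler_pXn2r _ 2) ?nnegrE// real_normK ?num_real//.
by rewrite (le_trans (phi_sqr_le2 _ _))//; lra.
Qed.

Lemma Rintegral_period_lin (f g : R -> R) (a b : R) :
  measurable_fun setT f -> (exists M, forall x, `|f x| <= M) ->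
  measurable_fun setT g -> (exists M, forall x, `|g x| <= M) ->
  \int[mu]_(x in `[0, 2 * pi]) (a * f x + b * g x) =
  a * \int[mu]_(x in `[0, 2 * pi]) f x + b * \int[mu]_(x in `[0, 2 * pi]) g x.
Proof.
move=> mf [M fM] mg [N gN].
rewrite RintegralD//; last 2 first.
- apply: period_integrable; first exact: measurable_funM.
  by exists (`|a| * M) => x; rewrite normrM ler_wpM2l.
- apply: period_integrable; first exact: measurable_funM.
  by exists (`|b| * N) => x; rewrite normrM ler_wpM2l.
by rewrite !RintegralZl//; apply: period_integrable => //; [exists N|exists M].
Qed.

(** Products become sums of waves of frequencies [d] (difference) and [s] (sum). A sine times a
    cosine leaves only sines, of integral 0. Otherwise the cosine of frequency [d] survives exactly
    when j = k. That of frequency [s] survives only for j = k = 1, where it makes up for the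
    amplitude 1 in place of sqrt 2. *)
Lemma phi_orthonormal j k : (0 < j)%N -> (0 < k)%N ->
  ipX (@phi R j) (phi k) = (j == k)%:R.
Proof.
move=> j0 k0; rewrite /ipX.
have bs w : exists M, forall x, `|sin (w * x)| <= M by exists 1 => x; exact: sin_max.
have bc w : exists M, forall x, `|cos (w * x)| <= M by exists 1 => x; exact: cos_max.
set A := phi_amp j * phi_amp k.
pose d : int := (j./2)%:Z - (k./2)%:Z.
pose s : int := (j./2)%:Z + (k./2)%:Z.
have dx x : d%:~R * x = (j./2)%:R * x - (k./2)%:R * x by rewrite /d intrB mulrBl.
have sx x : s%:~R * x = (j./2)%:R * x + (k./2)%:R * x by rewrite /s intrD mulrDl.
have pi_neq0 : pi != 0 :> R by rewrite gt_eqF// pi_gt0.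
have d0 : (d == 0) = (j./2 == k./2) by rewrite subr_eq0.
have s0 : (s == 0) = (j./2 == 0)%N && (k./2 == 0)%N.
  by rewrite /s -PoszD -addn_eq0.
(* The sign in front of the second wave: minus for sine times sine, plus for cosine times cosine;
   its opposite serves in the mixed case. *)
pose e (b : bool) : R := if b then -1 else 1.
have [jk|jk] := eqVneq (phi_isin j) (phi_isin k).
  transitivity ((2 * pi)^-1 * \int[mu]_(x in `[0, 2 * pi])
      ((A / 2) * cos (d%:~R * x) + (A / 2 * e (phi_isin j)) * cos (s%:~R * x))).
    congr (_ * _); apply: eq_Rintegral => x _.
    rewrite !phiE// -jk dx sx cosB cosD /e /A.
    by case: ifP => _; field.
  rewrite Rintegral_period_lin ?Rintegral_cos_freq//;
    try exact: measurable_cosM.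
  rewrite d0 s0.
  (* Each positive frequency carries one sine and one cosine, and frequency 0 only the index 1, so
     type and frequency determine the index. *)
  have -> : (j == k) = (j./2 == k./2).
    by move: jk; rewrite /phi_isin => jk; apply/eqP/eqP; lia.
  have [jkh|jkh] := eqVneq (j./2) (k./2); last first.
    have -> : (j./2 == 0)%N && (k./2 == 0)%N = false.
      by apply/negbTE; apply: contra jkh => /andP[/eqP-> /eqP->].
    by rewrite /= !mul0r !mulr0 addr0 ?mulr0.
  rewrite -jkh andbb; have [jh0|jhN0] := eqVneq (j./2) 0%N.
    have j1 : j = 1%N by lia.
    have k1 : k = 1%N by lia.
    rewrite /A /e j1 k1 /phi_amp /phi_isin /=.
    by move: (pi : R) pi_neq0 => p p0; field.
  have jN1 : (j == 1%N) = false by apply/negbTE; apply: contra jhN0 => /eqP ->.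
  have kN1 : (k == 1%N) = false.
    by apply/negbTE; apply: contra jhN0; rewrite jkh => /eqP ->.
  have -> : A = 2 by rewrite /A /phi_amp jN1 kN1 -expr2 sqr_sqrtr.
  rewrite mul0r mulr0 addr0 /=.
  by move: (pi : R) pi_neq0 => p p0; field.
have -> : (j == k) = false.
  by apply/negbTE; apply: contra jk => /eqP ->.
transitivity ((2 * pi)^-1 * \int[mu]_(x in `[0, 2 * pi])
    ((A / 2) * sin (s%:~R * x) + (A / 2 * - e (phi_isin j)) * sin (d%:~R * x))).
  congr (_ * _); apply: eq_Rintegral => x _.
  rewrite !phiE// dx sx sinB sinD /e /A.
  by move: jk; case: (phi_isin j); case: (phi_isin k) => // _; field.
by rewrite Rintegral_period_lin ?Rintegral_sin_freq ?mulr0 ?addr0 ?mulr0//;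
  exact: measurable_sinM.
Qed.

End fourier.

(** * Least squares *)

Local Arguments phi : simpl never.

Section least_squares.
Context {R : realType}.
Implicit Types (D n : nat).

Lemma lincombE D (c : nat -> R) x :
  lincomb D c x = \sum_(k < D) c k.+1 * phi k.+1 x.
Proof. by rewrite /lincomb big_add1 big_mkord. Qed.

Lemma lincombB D (c c' : nat -> R) x :
  lincomb D c x - lincomb D c' x = \sum_(k < D) (c k.+1 - c' k.+1) * phi k.+1 x.
Proof.
by rewrite !lincombE -sumrB; apply: eq_bigr => k _; rewrite mulrBl.
Qed.

Lemma lincomb_bounded D (c : nat -> R) : exists M, forall x, `|lincomb D c x| <= M.
Proof.
exists (\sum_(k < D) `|c k.+1| * 2) => x; rewrite lincombE.
rewrite (le_trans (ler_norm_sum _ _ _))//; apply: ler_sum => k _.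
by rewrite normrM ler_wpM2l// normr_phi_le2.
Qed.

Lemma measurable_lincomb D (c : nat -> R) : measurable_fun setT (lincomb D c).
Proof.
rewrite (_ : lincomb D c = fun x => \sum_(k < D) c k.+1 * phi k.+1 x); last first.
  by apply/funext => x; rewrite lincombE.
by apply: measurable_sum => k; apply: measurable_funM => //; exact: measurable_phi.
Qed.

Lemma ipX_sumr (I : Type) (s : seq I) (c : I -> R) (f : R -> R) (g : I -> R -> R) :
  measurable_fun setT f -> (exists M, forall x, `|f x| <= M) ->
  (forall i, measurable_fun setT (g i)) ->
  (forall i, exists M, forall x, `|g i x| <= M) ->
  ipX f (fun x => \sum_(i <- s) c i * g i x) = \sum_(i <- s) c i * ipX f (g i).
Proof.
move=> mf [M fM] mg /choice[N gN]; rewrite /ipX.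
under eq_Rintegral do rewrite mulr_sumr.
have ifg i : (@lebesgue_measure R).-integrable `[0, 2 * pi]
    (EFin \o (fun x => f x * g i x)).
  apply: period_integrable; first exact: measurable_funM.
  by exists (M * N i) => x; rewrite normrM ler_pM.
rewrite Rintegral_sum//; last first.
  move=> i; apply: period_integrable.
    by apply: measurable_funM => //; exact: measurable_funM.
  exists (M * (`|c i| * N i)) => x.
  by rewrite normrM ler_pM// normrM ler_wpM2l.
rewrite mulr_sumr; apply: eq_bigr => i _.
rewrite [RHS]mulrCA; congr (_ * _); rewrite -RintegralZl//.
by apply: eq_Rintegral => x _; rewrite mulrCA.
Qed.

Lemma ipXC (f g : R -> R) : ipX f g = ipX g f.
Proof.
by rewrite /ipX; congr (_ * _); apply: eq_Rintegral => x _; rewrite mulrC.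
Qed.

Lemma ipX_lincomb_phi D (c : nat -> R) (k : 'I_D) :
  ipX (lincomb D c) (phi k.+1) = c k.+1.
Proof.
rewrite ipXC (_ : lincomb D c = fun x => \sum_(k < D) c k.+1 * phi k.+1 x); last first.
  by apply/funext => x; rewrite lincombE.
have mp j : measurable_fun setT (@phi R j) by exact: measurable_phi.
have bp j : exists M, forall x, `|@phi R j x| <= M.
  by exists 2 => x; exact: normr_phi_le2.
rewrite (ipX_sumr _ (fun j : 'I_D => c j.+1) _ _ _ (fun j : 'I_D => bp j.+1))//.
rewrite (bigD1 k)//= phi_orthonormal// eqxx mulr1 big1 ?addr0// => j jk.
by rewrite phi_orthonormal// eqSS val_eqE eq_sym (negPf jk) mulr0.
Qed.

Lemma norm2sq_lincombB D (c c' : nat -> R) :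
  norm2sq (fun x => lincomb D c x - lincomb D c' x) =
  \sum_(k < D) (c k.+1 - c' k.+1) ^+ 2.
Proof.
have E x : lincomb D c x - lincomb D c' x = lincomb D (fun k => c k - c' k) x.
  by rewrite lincombB lincombE.
have mp j : measurable_fun setT (@phi R j) by exact: measurable_phi.
have bp j : exists M, forall x, `|@phi R j x| <= M.
  by exists 2 => x; exact: normr_phi_le2.
rewrite /norm2sq (_ : (fun x => _) = lincomb D (fun k => c k - c' k)); last first.
  exact/funext.
rewrite [X in ipX _ X](_ : _ =
    fun x => \sum_(k < D) (c k.+1 - c' k.+1) * phi k.+1 x); last first.
  by apply/funext => x; rewrite lincombE.
rewrite (ipX_sumr _ (fun k : 'I_D => c k.+1 - c' k.+1) _ _ _
  (fun k : 'I_D => bp k.+1))//; last 2 first.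
- exact: measurable_lincomb.
- exact: lincomb_bounded.
by apply: eq_bigr => k _; rewrite ipX_lincomb_phi expr2.
Qed.

(** No spectral argument: an entry changes the form by at most |a_j a_k| / (2D) <= (a_j^2 + a_k^2) /
    (4D), and summing over both indices gives half of the sum of the a_j^2. *)
Lemma gram_lower_bound D (a : 'I_D -> R) (G : 'I_D -> 'I_D -> R) :
  (forall j k, `|G j k - (j == k)%:R| <= 1 / (2 * D%:R)) ->
  (\sum_j a j ^+ 2) / 2 <= \sum_j \sum_k a j * a k * G j k.
Proof.
move=> hG; set S := \sum_j a j ^+ 2.
have [D0|D0] := posnP D.
  by rewrite /S; subst D; rewrite !big_ord0 mul0r.
have DR0 : D%:R != 0 :> R by rewrite pnatr_eq0 -lt0n.
apply: (@le_trans _ _ (\sum_j \sum_k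
    (a j * a k * (j == k)%:R - (a j ^+ 2 + a k ^+ 2) / (4 * D%:R)))); last first.
  apply: ler_sum => j _; apply: ler_sum => k _.
  rewrite lerBlDr -lerBlDl -mulrBr.
  rewrite (le_trans (ler_norm _))// normrM distrC.
  apply: (@le_trans _ _ (((a j ^+ 2 + a k ^+ 2) / 2) * (1 / (2 * D%:R)))).
    apply: ler_pM => //.
    rewrite normrM -(@real_normK _ (a j)) ?num_real//.
    rewrite -(@real_normK _ (a k)) ?num_real//.
    by have := sqr_ge0 (`|a j| - `|a k|); nra.
  by rewrite le_eqVlt; apply/orP; left; apply/eqP; field.
have diag : \sum_j \sum_k a j * a k * (j == k)%:R = S.
  apply: eq_bigr => j _; rewrite (bigD1 j)//= eqxx mulr1 big1 ?addr0// => k kj.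
  by rewrite eq_sym (negPf kj) mulr0.
have off : \sum_j \sum_k ((a j ^+ 2 + a k ^+ 2) / (4 * D%:R)) = S / 2.
  transitivity ((\sum_j \sum_k (a j ^+ 2 + a k ^+ 2)) / (4 * D%:R)).
    by rewrite mulr_suml; apply: eq_bigr => j _; rewrite mulr_suml.
  under eq_bigr do rewrite big_split/=.
  rewrite big_split/=.
  have -> : \sum_(j < D) \sum_(k < D) a j ^+ 2 = D%:R * S.
    rewrite mulr_sumr; apply: eq_bigr => j _.
    by rewrite sumr_const card_ord mulr_natl.
  have -> : \sum_(j < D) \sum_(k < D) a k ^+ 2 = D%:R * S.
    by rewrite sumr_const card_ord mulr_natl.
  by field.
under eq_bigr do rewrite sumrB.
by rewrite sumrB diag off; lra.
Qed.

Lemma least_squares_bound n D (xs ys : 'I_n -> R) (c b : nat -> R) :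
  (0 < n)%N ->
  emp_risk xs ys (lincomb D c) <= emp_risk xs ys (lincomb D b) ->
  (forall j k : 'I_D,
    `|n%:R^-1 * (\sum_(i < n) phi j.+1 (xs i) * phi k.+1 (xs i)) - (j == k)%:R|
      <= 1 / (2 * D%:R)) ->
  \sum_(k < D) (c k.+1 - b k.+1) ^+ 2 <=
  16 * \sum_(k < D)
    (n%:R^-1 * \sum_(i < n) (ys i - lincomb D b (xs i)) * phi k.+1 (xs i)) ^+ 2.
Proof.
move=> n0 risk hG.
pose a (k : 'I_D) := c k.+1 - b k.+1.
pose z i := ys i - lincomb D b (xs i).
pose w i := \sum_(k < D) a k * phi k.+1 (xs i).
pose nu (k : 'I_D) := n%:R^-1 * \sum_(i < n) z i * phi k.+1 (xs i).
have := gram_lower_bound a hG.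
have nV : 0 < n%:R^-1 :> R by rewrite invr_gt0 ltr0n.
have -> : \sum_j \sum_k a j * a k *
    (n%:R^-1 * (\sum_(i < n) phi j.+1 (xs i) * phi k.+1 (xs i))) =
    n%:R^-1 * \sum_i w i ^+ 2.
  transitivity (\sum_i \sum_j \sum_k
      n%:R^-1 * ((a j * phi j.+1 (xs i)) * (a k * phi k.+1 (xs i)))).
    rewrite [RHS]exchange_big/=; apply: eq_bigr => j _.
    rewrite [RHS]exchange_big/=; apply: eq_bigr => k _.
    by rewrite !mulr_sumr; apply: eq_bigr => i _; ring.
  rewrite mulr_sumr; apply: eq_bigr => i _.
  rewrite expr2 {1}/w mulr_suml mulr_sumr; apply: eq_bigr => j _.
  by rewrite /w !mulr_sumr.
have zw : n%:R^-1 * (\sum_i z i * w i) = \sum_k a k * nu k.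
  transitivity (\sum_i \sum_k n%:R^-1 * (z i * (a k * phi k.+1 (xs i)))).
    by rewrite mulr_sumr; apply: eq_bigr => i _; rewrite !mulr_sumr.
  rewrite exchange_big/=; apply: eq_bigr => k _.
  by rewrite /nu !mulr_sumr; apply: eq_bigr => i _; ring.
have : n%:R^-1 * (\sum_i w i ^+ 2) <= 2 * (n%:R^-1 * \sum_i z i * w i).
  move: risk; rewrite /emp_risk.
  have -> : \sum_(i < n) (ys i - lincomb D c (xs i)) ^+ 2 =
      \sum_i z i ^+ 2 - 2 * (\sum_i z i * w i) + \sum_i w i ^+ 2.
    rewrite mulr_sumr -sumrB -big_split/=; apply: eq_bigr => i _.
    have -> : ys i - lincomb D c (xs i) = z i - w i.
      by rewrite /z /w -lincombB; ring.
    by ring.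
  rewrite -/(\sum_i z i ^+ 2) !mulrDr; lra.
rewrite zw => h1 h2; have := le_trans h2 h1.
(* The weights let the doubled cross term absorb only S/4 of the lower bound S/2, with S the sum of
   the a_k^2. What remains is S/4 <= 4 sum nu_k^2, the origin of the factor 16. *)
have : \sum_k a k * nu k <= \sum_k (a k ^+ 2 / 8 + 2 * nu k ^+ 2).
  apply: ler_sum => k _; have := sqr_ge0 (a k - 4 * nu k); nra.
rewrite big_split/= -mulr_suml -mulr_sumr.
rewrite -/(\sum_k a k ^+ 2) -/(\sum_k nu k ^+ 2); lra.
Qed.

End least_squares.

(** * Second moments *)

Lemma eq_law_integral {d d' : measure_display} {T : measurableType d}
    {U : measurableType d'} {R : realType} (P : probability T R)
    (Z Z' : T -> U) (f : U -> \bar R) :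
  measurable_fun setT Z -> measurable_fun setT Z' ->
  (forall S, measurable S -> P (Z @^-1` S) = P (Z' @^-1` S)) ->
  measurable_fun setT f ->
  (\int[P]_t f (Z t) = \int[P]_t f (Z' t))%E.
Proof.
move=> mZ mZ' law mf.
pose Zm_mixin := isMeasurableFun.Build _ _ _ _ _ mZ'.
pose Zm : {mfun T >-> U} := HB.pack Z' Zm_mixin.
rewrite (@integral_image_law _ _ _ _ _ P Z (distribution P Zm))//.
by rewrite (@integral_image_law _ _ _ _ _ P Z' (distribution P Zm)).
Qed.

Section second_moments.
Context {d : measure_display} {T : measurableType d} {R : realType}.
Variable P : probability T R.

Lemma integrable_mul_sqr (f g : T -> R) :
  measurable_fun setT f -> measurable_fun setT g ->
  P.-integrable setT (EFin \o (fun t => f t ^+ 2)) ->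
  P.-integrable setT (EFin \o (fun t => g t ^+ 2)) ->
  P.-integrable setT (EFin \o (fun t => f t * g t)).
Proof.
move=> mf mg iff igg; apply: le_integrable (integrableD measurableT iff igg) => //.
  by apply/measurable_EFinP; exact: measurable_funM.
move=> t _ /=; rewrite lee_fin [leRHS]ger0_norm ?addr_ge0 ?sqr_ge0//.
rewrite ler_norml.
have := sqr_ge0 (f t - g t); have := sqr_ge0 (f t + g t).
have := sqr_ge0 (f t); have := sqr_ge0 (g t); nra.
Qed.

Lemma integrable_of_sqr (f : T -> R) :
  measurable_fun setT f -> P.-integrable setT (EFin \o (fun t => f t ^+ 2)) ->
  P.-integrable setT (EFin \o f).
Proof.
move=> mf iff.
have i1 : P.-integrable setT (EFin \o (fun t => (cst 1 t : R) ^+ 2)).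
  apply: bounded_integrable; first exact: measurable_funX.
  by exists 1 => t; rewrite expr1n normr1.
have := integrable_mul_sqr mf (@measurable_cst _ _ _ _ _ (1 : R)) iff i1.
by congr (integrable _ _ _); apply/funext => t /=; rewrite mulr1.
Qed.

(** Expanding the square leaves [n] diagonal terms, each at most [v], against the factor n^-2.
    Second moments suffice, since products of two terms are then integrable. *)
Lemma mean_square_uncorrelated n (h : 'I_n -> T -> R) (v : R) :
  (forall i, measurable_fun setT (h i)) ->
  (forall i, P.-integrable setT (EFin \o (fun t => h i t ^+ 2))) ->
  (forall i j, i != j -> \int[P]_t (h i t * h j t) = 0) ->
  (forall i, \int[P]_t (h i t ^+ 2) <= v) ->
  P.-integrable setT (EFin \o (fun t => (n%:R^-1 * \sum_i h i t) ^+ 2)) /\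
  \int[P]_t ((n%:R^-1 * \sum_i h i t) ^+ 2) <= v / n%:R.
Proof.
move=> mh ih hij hv.
have ihij i j : P.-integrable setT (EFin \o (fun t => h i t * h j t)).
  exact: integrable_mul_sqr.
have isum i : P.-integrable setT (EFin \o (fun t => \sum_j h i t * h j t)).
  rewrite (_ : EFin \o _ = (fun t => \sum_j (h i t * h j t)%:E)%E).
    by apply: integrable_sum => // j _; exact: ihij.
  by apply/funext => t /=; rewrite sumEFin.
have isum2 : P.-integrable setT (EFin \o (fun t => \sum_i \sum_j h i t * h j t)).
  rewrite (_ : EFin \o _ = (fun t => \sum_i (\sum_j h i t * h j t)%:E)%E).
    by apply: integrable_sum => // i _; exact: isum.
  by apply/funext => t /=; rewrite sumEFin.
have E : (fun t => (n%:R^-1 * \sum_i h i t) ^+ 2) =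
    (fun t => n%:R^-1 ^+ 2 * \sum_i \sum_j h i t * h j t).
  apply/funext => t; rewrite exprMn; congr (_ * _).
  by rewrite expr2 mulr_suml; apply: eq_bigr => i _; rewrite mulr_sumr.
rewrite E; split; first exact: (integrableZl measurableT _ isum2).
rewrite RintegralZl// Rintegral_sum//.
(* For n = 0 both sides are 0, as the inverse of 0 is 0. *)
have [n0|n0] := eqVneq n 0%N.
  by subst n; rewrite big_ord0 mulr0 mulr0n invr0 mulr0.
have nR : n%:R != 0 :> R by rewrite pnatr_eq0.
rewrite (_ : v / n%:R = n%:R^-1 ^+ 2 * (n%:R * v)); last by field.
rewrite ler_wpM2l// mulr_natl -[in leRHS](card_ord n) -sumr_const.
apply: ler_sum => i _; rewrite Rintegral_sum// (bigD1 i)//= big1.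
  by rewrite addr0; under eq_Rintegral do rewrite -expr2.
by move=> j ij; rewrite hij// eq_sym.
Qed.

Lemma markov_ge0 (V : T -> R) (e : R) : 0 < e -> measurable_fun setT V ->
  (forall t, 0 <= V t) -> P.-integrable setT (EFin \o V) ->
  (P [set t | (e <= V t)%R] <= (e^-1 * \int[P]_t V t)%:E)%E.
Proof.
move=> e0 mV V0 iV.
pose V_mixin := isMeasurableFun.Build _ _ _ _ _ mV.
pose Vm : {mfun T >-> R} := HB.pack V V_mixin.
have := @markov _ _ _ P Vm id e e0 (@measurable_id _ _ _) (fun r h => h).
move=> /(_ (fun x y _ _ h => h)); rewrite unlock.
rewrite EFinM lee_pdivlMl//.
rewrite (_ : [set x | _] = [set t | (e <= V t)%R]); last first.
  by apply/funext => t /=; rewrite lee_fin ger0_norm.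
move=> /le_trans; apply; rewrite /Rintegral fineK; last first.
  exact: integrable_fin_num.
rewrite le_eqVlt; apply/orP; left; apply/eqP; apply: eq_integral => t _ /=.
by rewrite ger0_norm.
Qed.

End second_moments.

(** * The regression model *)

Section regression_noise.
Context {d : measure_display} {T : measurableType d} {R : realType}.
Variables (P : probability T R) (X Y : T -> R) (sstar : R -> R).
Hypothesis mX : measurable_fun setT X.
Hypothesis mY : measurable_fun setT Y.
Hypothesis uX : uniform_0_2pi P X.

Lemma ge0_Rintegral_uniform (f : R -> R) :
  measurable_fun setT f -> (forall x, 0 <= f x) ->
  \int[P]_t f (X t) =
  (2 * pi)^-1 * \int[@lebesgue_measure R]_(x in `[0, 2 * pi]) f x.
Proof.
move=> mf f0.
have mEf : measurable_fun setT (EFin \o f) by exact/measurable_EFinP.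
have law S : measurable S -> P (X @^-1` S) = uniform_prob (@period_gt0 R) S.
  move=> mS; rewrite uX// /uniform_prob integral_uniform_pdf.
  rewrite (eq_integral (cst ((2 * pi)^-1)%:E)); last first.
    move=> x /[!inE] -[_ /=]; rewrite in_itv/= /uniform_pdf => ->.
    by rewrite subr0.
  by rewrite integral_cst//; exact: measurableI.
rewrite /Rintegral (@integral_image_law _ _ _ (measurableTypeR R) _ P X
  (uniform_prob (@period_gt0 R)) (EFin \o f) mX law mEf).
rewrite integral_uniform//.
rewrite subr0; set I := integral _ _ _.
(* If the integral is infinite, both real-valued sides are 0, because [fine] sends infinity to 0. *)
have [Ifin|] := boolP (I \is a fin_num); first by rewrite fineM.
have I0 : (0 <= I)%E by apply: integral_ge0 => x _; rewrite lee_fin.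
rewrite ge0_fin_numE// ltey negbK => /eqP ->.
by rewrite mulry gtr0_sg ?mul1e ?mulr0// invr_gt0 period_gt0.
Qed.

(** Adding the bound [M] makes [f] nonnegative, and the shift contributes [M] to both sides. *)
Lemma Rintegral_uniform (f : R -> R) :
  measurable_fun setT f -> (exists M, forall x, `|f x| <= M) ->
  \int[P]_t f (X t) =
  (2 * pi)^-1 * \int[@lebesgue_measure R]_(x in `[0, 2 * pi]) f x.
Proof.
move=> mf [M fM].
have mfM : measurable_fun setT (fun x => f x + M) by exact: measurable_funD.
have fM0 x : 0 <= f x + M by have := fM x; rewrite ler_norml => /andP[? _]; lra.
have := ge0_Rintegral_uniform mfM fM0.
rewrite RintegralD//; last 2 first.
- apply: bounded_integrable; last by exists M.
  exact: measurableT_comp.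
- by apply: bounded_integrable => //; exists `|M|.
rewrite RintegralD//; last 2 first.
- by apply: period_integrable => //; exists M.
- by apply: period_integrable => //; exists `|M|.
rewrite Rintegral_cstT Rintegral_period_cst mulrDr.
rewrite [X in _ = _ + X](_ : _ = M); first by move=> /addIr.
by rewrite mulrCA mulVf ?mulr1// gt_eqF// period_gt0.
Qed.

Hypothesis iY2 : P.-integrable setT (fun t => (Y t ^+ 2)%:E).
Hypothesis condY : is_condexp_fun P Y X sstar.
Hypothesis bs : exists M, forall x, `|sstar x| <= M.

(** The residual is the sum of [Y t - sstar (X t)], orthogonal to functions of X by conditional
    expectation, and of [sstar - projm D sstar] at X, orthogonal to [phi k.+1] because X is uniform
    and the projection keeps the coefficient. *)
Lemma residual_orthogonal D (k : 'I_D) :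
  \int[P]_t ((Y t - projm D sstar (X t)) * phi k.+1 (X t)) = 0.
Proof.
have [ms cond] := condY; have [M sM] := bs.
have mp := @measurable_phi R k.+1.
have mpX : measurable_fun setT (fun t => phi k.+1 (X t)) by exact: measurableT_comp.
have msX : measurable_fun setT (fun t => sstar (X t)) by exact: measurableT_comp.
have ml : measurable_fun setT (projm D sstar) by exact: measurable_lincomb.
have [N lN] : exists N, forall x, `|projm D sstar x| <= N by exact: lincomb_bounded.
have iY : P.-integrable setT (EFin \o Y) by exact: integrable_of_sqr.
have isX : P.-integrable setT (EFin \o (fun t => sstar (X t))).
  by apply: bounded_integrable => //; exists M.
pose G t := Y t - sstar (X t).
have iG : P.-integrable setT (EFin \o G).
  exact: (integrableB measurableT iY isX).
have mXA A : measurable A -> measurable (X @^-1` A).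
  by move=> mA; rewrite -[X in measurable X]setTI; exact: mX.
have G0 A : measurable A -> \int[P]_(t in X @^-1` A) G t = 0.
  move=> mA; rewrite RintegralB//; last 3 first.
  - exact: mXA.
  - by apply: integrableS iY => //; exact: mXA.
  - by apply: integrableS isX => //; exact: mXA.
  by rewrite /Rintegral cond// subrr.
have ipG : P.-integrable setT (EFin \o (fun t => phi k.+1 (X t) * G t)).
  apply: le_integrable (integrableZl measurableT 2 iG) => //.
    apply/measurable_EFinP; apply: measurable_funM => //.
    exact: measurable_funB.
  move=> t _ /=; rewrite lee_fin !normrM ler_wpM2r//.
  by rewrite (le_trans (normr_phi_le2 _ _))// ler_norm.
pose h x := (sstar x - projm D sstar x) * phi k.+1 x.
have mh : measurable_fun setT h.
  by apply: measurable_funM => //; exact: measurable_funB.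
have bh x : `|h x| <= (M + N) * 2.
  rewrite normrM ler_pM// ?normr_phi_le2//.
  by rewrite (le_trans (ler_normB _ _))// lerD.
have h0 : \int[P]_t h (X t) = 0.
  rewrite Rintegral_uniform//; last by exists ((M + N) * 2).
  rewrite (_ : h = fun x => 1 * (sstar x * phi k.+1 x)
      + (-1) * (projm D sstar x * phi k.+1 x)); last first.
    by apply/funext => x; rewrite /h; ring.
  rewrite Rintegral_period_lin; last 4 first.
  - exact: measurable_funM.
  - by exists (M * 2) => x; rewrite normrM ler_pM// normr_phi_le2.
  - exact: measurable_funM.
  - by exists (N * 2) => x; rewrite normrM ler_pM// normr_phi_le2.
  rewrite mul1r mulN1r mulrBr -[X in X - _]/(beta k.+1 sstar).
  rewrite -[X in _ - X]/(ipX (projm D sstar) (phi k.+1)).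
  by rewrite ipX_lincomb_phi subrr.
transitivity (\int[P]_t (phi k.+1 (X t) * G t + h (X t))).
  by apply: eq_Rintegral => t _; rewrite /G /h; ring.
rewrite RintegralD//; last first.
  apply: bounded_integrable; first exact: measurableT_comp.
  by exists ((M + N) * 2).
by rewrite h0 (Rintegral_comp_eq0 mX iG mp ipG G0) addr0.
Qed.

End regression_noise.

Lemma measure_bigsetU_le {d : measure_display} {T : measurableType d}
    {R : realType} (mu : {measure set T -> \bar R}) (I : Type) (s : seq I)
    (F : I -> set T) :
  (forall i, measurable (F i)) ->
  (mu (\big[setU/set0]_(i <- s) F i) <= \sum_(i <- s) mu (F i))%E.
Proof.
move=> mF; elim: s => [|i s IH]; first by rewrite !big_nil measure0.
rewrite !big_cons (le_trans (measureU2 _ _ _))//.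
  by apply: bigsetU_measurable => j _; exact: mF.
by rewrite leeD2l.
Qed.

Section iid_events.
Context {d : measure_display} {T : measurableType d} {R : realType}.
Variables (P : probability T R) (X Y : T -> R) (n : nat) (Xs Ys : 'I_n -> T -> R).
Hypothesis mX : measurable_fun setT X.
Hypothesis mY : measurable_fun setT Y.
Hypothesis iid : iid_sample P X Y Xs Ys.

Let mXs i : measurable_fun setT (Xs i).
Proof. by case: iid => /(_ i)[]. Qed.

Let mYs i : measurable_fun setT (Ys i).
Proof. by case: iid => /(_ i)[]. Qed.

Let W i t := (Xs i t, Ys i t).

Let mW i : measurable_fun setT (W i).
Proof. exact: measurable_fun_pair (mXs i) (mYs i). Qed.

Lemma iid_law i (S : set (R * R)) : measurable S ->
  P ((fun t => (Xs i t, Ys i t)) @^-1` S) = P ((fun t => (X t, Y t)) @^-1` S).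
Proof.
move: S; apply: (eq_law_rectangles (mW i) (measurable_fun_pair mX mY)).
by case: iid => _ law _ A B; exact: law.
Qed.

Lemma iid_law_fst i (A : set R) : measurable A ->
  P (Xs i @^-1` A) = P (X @^-1` A).
Proof.
move=> mA; have [_ law _] := iid; have := law i A setT mA measurableT.
by rewrite !preimage_setT !setIT.
Qed.

Lemma iid_indep_fst (A : 'I_n -> set R) : (forall i, measurable (A i)) ->
  P (\bigcap_(i in [set: 'I_n]) (Xs i @^-1` A i)) =
  (\big[*%E/1%E]_(i < n) P (Xs i @^-1` A i))%E.
Proof.
move=> mA; have [_ _ indep] := iid.
have := indep A (fun=> setT) (fun i => conj (mA i) measurableT).
under eq_bigcapr do rewrite preimage_setT setIT.
by under eq_bigr do rewrite preimage_setT setIT.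
Qed.

Lemma iid_indep_pair i j (A B A' B' : set R) : i != j ->
  measurable A -> measurable B -> measurable A' -> measurable B' ->
  P (W i @^-1` (A `*` B) `&` W j @^-1` (A' `*` B')) =
  (P (W i @^-1` (A `*` B)) * P (W j @^-1` (A' `*` B')))%E.
Proof.
move=> ij mA mB mA' mB'; have [_ _ indep] := iid.
(* Joint independence is restricted to two observations by putting the whole space at every other
   index, where the factor is 1. *)
pose pick (C C' : set R) l := if l == i then C else if l == j then C' else setT.
have pick_i C C' : pick C C' i = C by rewrite /pick eqxx.
have pick_j C C' : pick C C' j = C' by rewrite /pick eq_sym (negPf ij) eqxx.
have pick_T C C' l : l != i -> l != j -> pick C C' l = setT.
  by rewrite /pick => /negPf -> /negPf ->.
have mpick C C' l : measurable C -> measurable C' -> measurable (pick C C' l).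
  by move=> mC mC'; rewrite /pick; case: ifP => // _; case: ifP.
have := indep (pick A A') (pick B B')
  (fun l => conj (mpick A A' l mA mA') (mpick B B' l mB mB')).
rewrite (bigD1 i)//= (bigD1 j)/=; last by rewrite eq_sym.
rewrite big1 ?mule1; last first.
  move=> l /andP[li lj]; rewrite !pick_T// !preimage_setT setIT.
  exact: probability_setT.
rewrite !pick_i !pick_j => <-; congr (P _); apply/seteqP; split => t /=.
  move=> [[Ai Bi] [Aj Bj]] l _ /=.
  have [->|li] := eqVneq l i; first by rewrite !pick_i.
  have [->|lj] := eqVneq l j; first by rewrite !pick_j.
  by rewrite !pick_T.
move=> h; have := h i I; have := h j I.
by rewrite /= !pick_i !pick_j.
Qed.

(** * Deviation of the empirical Gram matrix from the identity *)

Section gram.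
Hypothesis uX : uniform_0_2pi P X.

Lemma uniform_sample i : uniform_0_2pi P (Xs i).
Proof. by move=> A mA; rewrite iid_law_fst// uX. Qed.

(** The sign given by [e] turns the one-sided tail bound into control of the absolute value. *)
Let g (e : bool) (j k : nat) (x : R) : R :=
  (-1) ^+ e * (phi j.+1 x * phi k.+1 x - (j == k)%:R).

Let mg e j k : measurable_fun setT (g e j k).
Proof.
apply: measurable_funM => //; apply: measurable_funB => //.
by apply: measurable_funM; exact: measurable_phi.
Qed.

Let gb e j k x : `|g e j k x| <= 5.
Proof.
rewrite normrMsign (le_trans (ler_normB _ _))// normrM.
have : `|phi j.+1 x| * `|phi k.+1 x| <= 2 * 2 by rewrite ler_pM// normr_phi_le2.
have : `|(j == k)%:R : R| <= 1 by case: (j == k); rewrite ?normr1 ?normr0.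
lra.
Qed.

Let g0 e j k i : \int[P]_t g e j k (Xs i t) = 0.
Proof.
rewrite (Rintegral_uniform (mXs i) (uniform_sample i))//; last by exists 5.
pose b := (-1) ^+ e : R.
transitivity ((2 * pi)^-1 * \int[@lebesgue_measure R]_(x in `[0, 2 * pi])
    (b * (phi j.+1 x * phi k.+1 x) + (- b * (j == k)%:R) * cst 1 x)).
  by congr (_ * _); apply: eq_Rintegral => x _; rewrite /g /b /cst; ring.
rewrite Rintegral_period_lin//; last 3 first.
- by apply: measurable_funM; exact: measurable_phi.
- by exists (2 * 2) => x; rewrite normrM ler_pM// normr_phi_le2.
- by exists 1 => x; rewrite normr1.
rewrite Rintegral_period_cst mul1r mulrDr mulrCA -[X in b * X]/(ipX _ _).
rewrite phi_orthonormal// eqSS [X in _ + X](_ : _ = - b * (j == k)%:R).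
  by ring.
by rewrite mulrCA mulVf ?mulr1// gt_eqF// period_gt0.
Qed.

Lemma gram_tail (e : bool) (j k : nat) (s : R) : 0 < s -> s <= 10 ->
  (P [set t | (s * n%:R <= \sum_(i < n) g e j k (Xs i t))%R] <=
   (expR (- (n%:R * s ^+ 2 / 200)))%:E)%E.
Proof.
move=> s0 s10.
have := @tail_bound _ _ _ _ _ P n Xs mXs iid_indep_fst (g e j k) 5
  (mg e j k) (ltr0n _ _) (gb e j k) (g0 e j k) s s0.
rewrite (_ : 8 * 5 ^+ 2 = 200); last by ring.
by apply; lra.
Qed.

(** The threshold 1 / (2D) is the entrywise error that [gram_lower_bound] tolerates. A finite union
    over entries and signs makes the event measurable and ready for a union bound. *)
Definition gram_bad D : set T := \big[setU/set0]_(p : 'I_D * 'I_D * bool)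
  [set t | (1 / (2 * D%:R) * n%:R <= \sum_(i < n) g p.2 p.1.1 p.1.2 (Xs i t))%R].

Let measurable_bad c e j k :
  measurable [set t | (c <= \sum_(i < n) g e j k (Xs i t))%R].
Proof.
have mS : measurable_fun setT (fun t => \sum_(i < n) g e j k (Xs i t)).
  by apply: measurable_sum => i; exact: (measurableT_comp (mg e j k) (mXs i)).
rewrite (_ : [set t | _] = setT `&`
    (fun t => \sum_(i < n) g e j k (Xs i t)) @^-1` `[c, +oo[).
  by apply: mS.
by rewrite setTI; apply/funext => t /=; rewrite in_itv/= andbT.
Qed.

Lemma measurable_gram_bad D : measurable (gram_bad D).
Proof. by apply: bigsetU_measurable => p _; exact: measurable_bad. Qed.

Lemma gram_good D (t : T) : (0 < n)%N -> ~ gram_bad D t -> forall j k : 'I_D,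
  `|n%:R^-1 * (\sum_(i < n) phi j.+1 (Xs i t) * phi k.+1 (Xs i t)) - (j == k)%:R|
  <= 1 / (2 * D%:R).
Proof.
move=> n0 ngood j k; have nR : 0 < n%:R :> R by rewrite ltr0n.
have notbad e : \sum_(i < n) g e j k (Xs i t) < 1 / (2 * D%:R) * n%:R.
  rewrite ltNge; apply/negP => bad; apply: ngood.
  by rewrite /gram_bad (bigD1 (j, k, e))//=; left.
have gE e : \sum_(i < n) g e j k (Xs i t) = (-1) ^+ e * n%:R *
    (n%:R^-1 * (\sum_(i < n) phi j.+1 (Xs i t) * phi k.+1 (Xs i t)) - (j == k)%:R).
  rewrite /g -mulr_sumr sumrB sumr_const card_ord -[_ *+ n]mulr_natl -mulrA.
  by congr (_ * _); field; rewrite gt_eqF.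
have := notbad false; have := notbad true; rewrite !gE expr0 expr1.
set q := (_ - _); set r := 1 / _ => h1 h2.
rewrite ler_norml; apply/andP; split; apply/ltW; rewrite -(ltr_pM2r nR); lra.
Qed.

(** There are 2 D^2 events, and s = 1 / (2D) in [gram_tail] gives the exponent n / (800 D^2). *)
Lemma gram_bad_prob D : (0 < D)%N ->
  (P (gram_bad D) <= (2 * D%:R ^+ 2 * expR (- (n%:R / (800 * D%:R ^+ 2))))%:E)%E.
Proof.
move=> D0; have DR : 0 < D%:R :> R by rewrite ltr0n.
have D1 : 1 <= D%:R :> R by rewrite ler1n.
apply: (@le_trans _ _ (\sum_(p : 'I_D * 'I_D * bool)
    (expR (- (n%:R / (800 * D%:R ^+ 2))))%:E)%E).
  apply: le_trans.
    by apply: measure_bigsetU_le => p; exact: measurable_bad.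
  apply: lee_sum => p _; apply: (le_trans (gram_tail _ _ _ _ _)).
  - by rewrite divr_gt0// mulr_gt0.
  - by rewrite ler_pdivrMr ?mulr_gt0//; lra.
  rewrite lee_fin ler_expR lerN2 le_eqVlt; apply/orP; left; apply/eqP.
  by field; rewrite gt_eqF.
rewrite sumEFin lee_fin sumr_const !card_prod card_ord card_bool.
by rewrite -[X in X <= _]mulr_natl !natrM expr2 ler_wpM2r ?expR_ge0//; lra.
Qed.

End gram.

(** * Second moments of the empirical noise coefficients *)

Section noise.
Variables (sstar : R -> R) (sigma : R) (D : nat).
Hypothesis uX : uniform_0_2pi P X.
Hypothesis iY2 : P.-integrable setT (fun t => (Y t ^+ 2)%:E).
Hypothesis condY : is_condexp_fun P Y X sstar.
Hypothesis bs : exists M, forall x, `|sstar x| <= M.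
Hypothesis noise2 :
  (\int[P]_t ((Y t - projm D sstar (X t)) ^+ 2)%:E <= (sigma ^+ 2)%:E)%E.

Let g (k : nat) (z : R * R) : R := (z.2 - projm D sstar z.1) * phi k.+1 z.1.

Let mg k : measurable_fun setT (g k).
Proof.
have m1 : measurable_fun setT (fun z : R * R => projm D sstar z.1).
  by apply: measurableT_comp => //; exact: measurable_lincomb.
have m2 : measurable_fun setT (fun z : R * R => @phi R k.+1 z.1).
  by apply: measurableT_comp => //; exact: measurable_phi.
by apply: measurable_funM => //; exact: measurable_funB.
Qed.

Let mg2 k : measurable_fun setT (fun z => (g k z ^+ 2)%:E).
Proof. by apply/measurable_EFinP; exact: measurable_funX. Qed.

Let mgW k i : measurable_fun setT (fun t => g k (W i t)).
Proof. exact: (measurableT_comp (mg k) (mW i)). Qed.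

(** The factor 2 bounds the square of [phi] pointwise. Stating it in the extended reals makes it a
    proof of finiteness as well, from which [integrable_g2] follows. *)
Let second_moment k i : (\int[P]_t (g k (W i t) ^+ 2)%:E <= (2 * sigma ^+ 2)%:E)%E.
Proof.
rewrite (eq_law_integral (mW i) (measurable_fun_pair mX mY)
  (@iid_law i) (mg2 k)).
have mzeta : measurable_fun setT (fun t => ((Y t - projm D sstar (X t)) ^+ 2)%:E).
  apply/measurable_EFinP; apply: measurable_funX; apply: measurable_funB => //.
  by apply: measurableT_comp => //; exact: measurable_lincomb.
apply: (@le_trans _ _ (\int[P]_t (2%:E * ((Y t - projm D sstar (X t)) ^+ 2)%:E)))%E.
  apply: ge0_le_integral => //.
  - by move=> t _; rewrite lee_fin sqr_ge0.
  - exact: (measurableT_comp (mg2 k) (measurable_fun_pair mX mY)).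
  - exact: emeasurable_funM.
  - move=> t _; rewrite -EFinM lee_fin /g exprMn mulrC ler_wpM2r ?sqr_ge0//.
    exact: phi_sqr_le2.
rewrite ge0_integralZl//; last by move=> t _; rewrite lee_fin sqr_ge0.
by rewrite EFinM lee_wpmul2l.
Qed.

Let integrable_g2 k i : P.-integrable setT (EFin \o (fun t => g k (W i t) ^+ 2)).
Proof.
apply/integrableP; split.
  exact: (measurableT_comp (mg2 k) (mW i)).
apply: (@le_lt_trans _ _ (\int[P]_t (g k (W i t) ^+ 2)%:E)%E).
  rewrite le_eqVlt; apply/orP; left; apply/eqP; apply: eq_integral => t _ /=.
  by rewrite ger0_norm ?sqr_ge0.
by rewrite (le_lt_trans (second_moment k i))// ltry.
Qed.

Let mean0 (k : 'I_D) i : \int[P]_t g k (W i t) = 0.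
Proof.
rewrite -(residual_orthogonal mX mY uX iY2 condY bs k).
congr fine; apply: (eq_law_integral (mW i) (measurable_fun_pair mX mY)
  (@iid_law i) (f := EFin \o g k)).
by apply/measurable_EFinP; exact: mg.
Qed.

Let uncorr (k : 'I_D) i j : i != j ->
  \int[P]_t (g k (W i t) * g k (W j t)) = 0.
Proof.
move=> ij; apply: (Rintegral_indep_mul_eq0 (mW j) (mW i) _ (mg k) (mg k)).
- by move=> A B A' B' mA mB mA' mB'; rewrite iid_indep_pair// eq_sym.
- by apply: integrable_of_sqr; [exact: mgW|exact: integrable_g2].
- by apply: integrable_mul_sqr; [exact: mgW|exact: mgW|exact: integrable_g2..].
- exact: mean0.
Qed.

Definition noise_energy (t : T) : R := \sum_(k < D)
  (n%:R^-1 * \sum_(i < n) (Ys i t - projm D sstar (Xs i t)) * phi k.+1 (Xs i t)) ^+ 2.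

Lemma measurable_noise_energy : measurable_fun setT noise_energy.
Proof.
apply: measurable_sum => k; apply: measurable_funX; apply: measurable_funM => //.
by apply: measurable_sum => i; exact: mgW.
Qed.

Lemma noise_energy_prob (e : R) : 0 < e ->
  (P [set t | (e <= noise_energy t)%R] <=
   (e^-1 * (2 * D%:R * sigma ^+ 2 / n%:R))%:E)%E.
Proof.
move=> e0.
have ms (k : 'I_D) := @mean_square_uncorrelated _ _ _ P n (fun i t => g k (W i t))
  (2 * sigma ^+ 2) (mgW k) (integrable_g2 k) (@uncorr k).
have {}ms (k : 'I_D) : P.-integrable setT
    (EFin \o (fun t => (n%:R^-1 * \sum_(i < n) g k (W i t)) ^+ 2)) /\
    \int[P]_t ((n%:R^-1 * \sum_(i < n) g k (W i t)) ^+ 2) <= 2 * sigma ^+ 2 / n%:R.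
  apply: ms => i; rewrite -lee_fin (le_trans _ (second_moment k i))//.
  rewrite /Rintegral fineK//.
  exact: (integrable_fin_num measurableT (integrable_g2 k i)).
have iV : P.-integrable setT (EFin \o noise_energy).
  rewrite (_ : EFin \o _ =
    (fun t => \sum_(k < D) ((n%:R^-1 * \sum_(i < n) g k (W i t)) ^+ 2)%:E)%E).
    by apply: integrable_sum => // k _; exact: (ms k).1.
  by apply/funext => t /=; rewrite sumEFin.
apply: (le_trans (markov_ge0 e0 measurable_noise_energy _ iV)).
  by move=> t; apply: sumr_ge0 => k _; exact: sqr_ge0.
rewrite lee_fin ler_wpM2l ?invr_ge0 ?(ltW e0)//.
rewrite /noise_energy Rintegral_sum//; last by move=> k; exact: (ms k).1.
apply: (@le_trans _ _ (\sum_(k < D) (2 * sigma ^+ 2 / n%:R))).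
  by apply: ler_sum => k _; exact: (ms k).2.
rewrite sumr_const card_ord -[X in X <= _]mulr_natl le_eqVlt; apply/orP; left.
by apply/eqP; ring.
Qed.

End noise.

End iid_events.

(** * The theorem *)

(** The exponent is at most 1/2 and n / ln n is at least 1, so the power is at most the square root;
    3600 is the square of 60. *)
Lemma dimension_bound {R : realType} (nu : R) (D n : nat) :
  1 / 2 < nu -> (1 < n)%N ->
  D%:R <= 60^-1 * (n%:R / ln n%:R) `^ ((2 * (nu + 1))^-1) ->
  3600 * D%:R ^+ 2 * ln (n%:R : R) <= n%:R.
Proof.
move=> hnu n1 hD; have nR : 1 < n%:R :> R by rewrite ltr1n.
have ln0 : 0 < ln (n%:R : R) by exact: ln_gt0.
set a := n%:R / ln n%:R in hD.
have a1 : 1 <= a by rewrite ler_pdivlMr// mul1r ltW// ln_sublinear//; lra.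
have hD2 : D%:R <= 60^-1 * Num.sqrt a.
  apply: (le_trans hD); rewrite ler_wpM2l// -powR12_sqrt; last by lra.
  by apply: ler_powR => //; rewrite lef_pV2 ?posrE; lra.
have : D%:R ^+ 2 <= (60^-1 * Num.sqrt a) ^+ 2.
  by rewrite lerXn2r ?nnegrE ?mulr_ge0// sqrtr_ge0.
rewrite exprMn sqr_sqrtr; last by lra.
move=> hD3; rewrite -ler_pdivlMr// -/a; lra.
Qed.

(** The hypothesis gives n / (800 D^2) >= 4.5 ln n, so the exponential is at most n^-4. As ln n >=
    1/2, it also gives 2 D^2 <= n <= n^2. *)
Lemma gram_failure_rate {R : realType} (D n : nat) :
  (0 < D)%N -> (1 < n)%N -> 3600 * D%:R ^+ 2 * ln (n%:R : R) <= n%:R ->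
  2 * D%:R ^+ 2 * expR (- (n%:R / (800 * D%:R ^+ 2))) <= n%:R ^- 2 :> R.
Proof.
move=> D0 n1.
have nR : 2 <= n%:R :> R by rewrite ler_nat.
have D2 : 0 < D%:R ^+ 2 :> R by rewrite exprn_gt0// ltr0n.
have pos : 0 < 800 * D%:R ^+ 2 :> R.
  by apply: mulr_gt0 D2; rewrite ltr0n.
(* At 1/2 the quadratic bound of the exponential equals 2, which is at most n. *)
have lnn : 1 / 2 <= ln (n%:R : R).
  rewrite -ler_expR lnK; last by rewrite posrE; lra.
  apply: (le_trans (expR_le_quadratic _)); last by lra.
  by rewrite ger0_norm.
move=> hD; apply: (@le_trans _ _ (n%:R ^+ 2 * n%:R ^- 4)); last first.
  by rewrite le_eqVlt; apply/orP; left; apply/eqP; field; rewrite gt_eqF//; lra.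
apply: ler_pM.
- by rewrite mulr_ge0// ltW.
- exact: expR_ge0.
- nra.
have -> : n%:R ^- 4 = expR (- (4%:R * ln n%:R)) :> R.
  rewrite expRN expRM_natl lnK// posrE; exact: lt_le_trans nR.
rewrite ler_expR lerN2 (ler_pdivlMr _ _ pos).
have : 0 <= D%:R ^+ 2 * ln (n%:R : R) by rewrite mulr_ge0//; lra.
move: hD; move: (D%:R ^+ 2) (ln (n%:R : R)) (n%:R : R) => u v w; lra.
Qed.

Theorem theorem3 (R : realType) (nu : R) (hnu : 1 / 2 < nu) :
  exists Lnu : R, 0 < Lnu /\
  forall L1 L2 : R, 0 < L1 -> 0 < L2 ->
  exists (C beta0 : R) (n0 : nat), 0 < C /\ 0 < beta0 /\
  forall sigma : R, 0 < sigma ->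
  exists Lsig : R, 0 < Lsig /\
  forall (d : measure_display) (T : measurableType d) (P : probability T R)
    (X Y : T -> R) (sstar : R -> R) (D n : nat)
    (Xs Ys : 'I_n -> T -> R) (shat : T -> nat -> R) (x : R),
    measurable_fun setT X -> measurable_fun setT Y ->
    (forall t, 0 <= X t <= 2 * pi) ->
    uniform_0_2pi P X ->
    P.-integrable setT (fun t => (Y t ^+ 2)%:E) ->
    is_condexp_fun P Y X sstar ->
    Lambda nu L1 L2 sstar ->
    indep2 P X (fun t => Y t - projm D sstar (X t)) ->
    (\int[P]_t ((Y t - projm D sstar (X t)) ^+ 2)%:E <= (sigma ^+ 2)%:E)%E ->
    iid_sample P X Y Xs Ys ->
    (* shat t : coefficients of a least-squares estimator in m, for each outcome t *)
    (forall t (c : nat -> R),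
       emp_risk (fun i => Xs i t) (fun i => Ys i t) (lincomb D (shat t))
       <= emp_risk (fun i => Xs i t) (fun i => Ys i t) (lincomb D c)) ->
    0 < (2 * Num.sqrt 2 * L1 / L2) `^ (nu^-1) ->
    (2 * Num.sqrt 2 * L1 / L2) `^ (nu^-1) <= D%:R ->
    D%:R <= Lnu * (n%:R / ln n%:R) `^ ((2 * (nu + 1))^-1) ->
    0 < x -> x < Lsig * n%:R / D%:R `^ (2 * (nu + 1)) ->
    (n0 <= n)%N ->
    exists A : set T, measurable A /\
      ((1 - expR (- (beta0 ^+ 2 * n%:R / 4)) - n%:R ^- 2 - 2 / x)%:E <= P A)%E /\
      forall t, A t ->
        norm2sq (fun u => lincomb D (shat t) u - projm D sstar u)
        <= C * sigma ^+ 2 * D%:R * x / n%:R.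
Proof.
(* The constant that [dimension_bound] asks for. *)
exists 60^-1; split; first by rewrite invr_gt0.
(* 16 is the factor in [least_squares_bound], and n >= 2 makes ln n positive. *)
move=> L1 L2 L1_gt0 L2_gt0; exists 16, 1, 2%N.
split => //; split => // sigma sigma_gt0; exists 1; split => //.
move=> d T P X Y sstar D n Xs Ys shat x mX mY _ uX iY2 condY [[_ _ bs] _ _] _.
move=> noise2 iid shat_min D_gt0 D_ge D_le x_gt0 _ n_ge2.
have D0 : (0 < D)%N by rewrite -(ltr0n R); exact: lt_le_trans D_ge.
have n0 : (0 < n)%N by exact: leq_trans n_ge2.
have nR : 0 < n%:R :> R by rewrite ltr0n.
have DR : 0 < D%:R :> R by rewrite ltr0n.
have rate := gram_failure_rate D0 n_ge2 (dimension_bound hnu n_ge2 D_le).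
(* Chosen so that Markov's inequality with mean at most 2 D sigma^2 / n gives exactly 2 / x; the
   final bound is then [16 * e]. *)
pose e : R := sigma ^+ 2 * D%:R * x / n%:R.
have e_gt0 : 0 < e by rewrite divr_gt0// !mulr_gt0// exprn_gt0.
pose V := noise_energy Xs Ys sstar D.
have mV : measurable_fun setT V by exact: (measurable_noise_energy iid sstar D).
have mB1 : measurable (gram_bad Xs D) by exact: (measurable_gram_bad iid).
have mB2 : measurable [set t | (e <= V t)%R].
  rewrite (_ : [set t | _] = setT `&` V @^-1` `[e, +oo[); first exact: mV.
  by rewrite setTI; apply/funext => t /=; rewrite in_itv/= andbT.
have PB1 := gram_bad_prob iid uX D0.
have PB2 : (P [set t | (e <= V t)%R] <= (2 / x)%:E)%E.
  apply: (le_trans (noise_energy_prob mX mY iid uX iY2 condY bs noise2 e_gt0)).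
  rewrite lee_fin le_eqVlt; apply/orP; left; apply/eqP; rewrite /e.
  by field; rewrite !gt_eqF.
exists (~` (gram_bad Xs D `|` [set t | (e <= V t)%R])); split; last split.
- by apply: measurableC; exact: measurableU.
- rewrite probability_setC; last exact: measurableU.
  have PB : (P (gram_bad Xs D `|` [set t | (e <= V t)%R]) <=
      (n%:R ^- 2 + 2 / x)%:E)%E.
    apply: (le_trans (measureU2 _ mB1 mB2)); rewrite EFinD leeD//.
    by apply: (le_trans PB1); rewrite lee_fin.
  apply: (@le_trans _ _ (1 - (n%:R ^- 2 + 2 / x)%:E)%E); last exact: leeB.
  by rewrite -EFinB lee_fin; have := expR_ge0 (- (1 ^+ 2 * n%:R / 4) : R); lra.
- move=> t /not_orP[gram /negP]; rewrite -ltNge => Vt.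
  rewrite (norm2sq_lincombB D (shat t) (fun k => beta k sstar)).
  apply: (le_trans (least_squares_bound n0 (shat_min t (fun k => beta k sstar))
    (gram_good n0 gram))).
  rewrite (_ : 16 * _ * _ * _ / _ = 16 * e); last by rewrite /e; ring.
  by rewrite ler_pM2l// ltW.
Qed.
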